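(* Let $S\subseteq[n-1]$, and let $\rho,\sigma\in\mathfrak S_n$ with $w_0(S)\preceq_L\rho$ and $\sigma\preceq_L w_1(S)$. (a) If $\mathscr D:=D_{S;\rho}$ is free of a strictly upper-right configuration, then $$\mathsf B\big([\,w_0(\mathrm{Des}_L(\mathrm w_{BL}(F_{\mathscr D}^{\rightarrow}))),\ w_1(\mathrm{set}(\mathsf r(\mathscr D)))\,]_L\big)$$ is an injective hull of $\mathsf B([w_0(S),\rho]_L)$. (b) If $\mathscr E:=D_{\sigma;S}$ is free of a strictly upper-right configuration, then $$\mathsf B\big([\,w_0(\mathrm{set}(\mathsf c(\mathscr E))^{c}),\ w_1(\mathrm{Des}_L(\mathrm w_{LB}(F_{\mathscr E}^{\downarrow})))\,]_L\big)$$ is a projective cover of $\mathsf B([\sigma,w_1(S)]_L)$.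
   Context: Permutations. $n$ is a positive integer, $[n]=\{1,\dots,n\}$, $\mathfrak S_n$ the symmetric group (product = composition of maps; permutations written as words), $s_i=(i,i+1)$, $\ell$ Coxeter length, $w_0$ the longest element. $\mathrm{Des}_L(\sigma)=\{i:\ell(s_i\sigma)<\ell(\sigma)\}$, $\mathrm{Des}_R(\sigma)=\{i:\ell(\sigma s_i)<\ell(\sigma)\}$. $\preceq_L$ has covers $\sigma\prec s_i\sigma$ for $i\notin\mathrm{Des}_L(\sigma)$; $[\sigma,\rho]_L$ is the interval for $\preceq_L$. For $S\subseteq[n-1]$, $S^{c}=[n-1]\setminus S$; $w_0(S)$ is the longest element of the subgroup generated by $\{s_i:i\in S\}$; $w_1(S)=w_0w_0(S^c)$ is the longest element of $\{z:\mathrm{Des}_R(z)\subseteq S\}$. For a composition $\alpha=(\alpha_1,\dots,\alpha_l)$ of $n$, $\mathrm{set}(\alpha)=\{\alpha_1,\dots,\alpha_1+\dots+\alpha_{l-1}\}$. Modules. $H_n(0)$ is the unital associative $\mathbb C$-algebra generated by $\pi_1,\dots,\pi_{n-1}$ with $\pi_i^2=\pi_i$, $\pi_i\pi_{i+1}\pi_i=\pi_{i+1}\pi_i\pi_{i+1}$, $\pi_i\pi_j=\pi_j\pi_i$ for $|i-j|\ge2$. For a nonempty left weak Bruhat interval $I$, $\mathsf B(I)$ is the left $H_n(0)$-module with basis $I$ and $\pi_i\cdot\gamma=\gamma$ if $i\in\mathrm{Des}_L(\gamma)$; $=0$ if $i\notin\mathrm{Des}_L(\gamma)$ and $s_i\gamma\notin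 I$; $=s_i\gamma$ if $i\notin\mathrm{Des}_L(\gamma)$ and $s_i\gamma\in I$. ''Injective hull''/''projective cover'' are in the category of finitely generated left $H_n(0)$-modules; saying that a module is an injective hull (projective cover) of $M$ means that it is the underlying module of one. Diagrams. $\mathfrak D_n$ is the set of $n$-element subsets $D\subset\mathbb Z_{>0}^2$ (boxes $(x,y)$, $x$ = column from the left, $y$ = row from the bottom) with no empty row or column up to the number of rows/columns. $\mathsf r(D)$ (resp. $\mathsf c(D)$) lists the numbers of boxes in rows from top to bottom (resp. columns from left to right). $D$ is free of a strictly upper-right configuration if there are no two boxes $(x_1,y_1),(x_2,y_2)\in D$ with $x_1<x_2$, $y_1<y_2$ such that no other box of $D$ lies in the smallest rectangle containing both. $F_D^{\downarrow}$ is the filling of $D$ placing $1,\dots,n$ down columns (top to bottom), leftmost column first; $F_D^{\rightarrow}$ places $1,\dots,n$ along rows left to right, top row first. $\mathrm w_{BL}$ reads each column bottom to top, leftmost column first; $\mathrm w_{LB}$ reads each row left to right, bottom row first. The diagram $D_{S;\rho}$. Write $S^c=\{z_1<\dots<z_p\}$, $z_0=0$, $z_{p+1}=n$, and $\mathrm{Des}_L(\rho)=\{q_1<\dots<q_e\}$, $q_0=0$, $q_{e+1}=n$; $X_i=\{\rho(r):z_{i-1}+1\le r\le z_i\}$, $Y_j=\{c:q_{j-1}+1\le c\le q_j\}$; $D_{S;\rho}=\{(i,j):X_i\cap Y_j\ne\emptyset\}$. The diagram $D_{\sigma;S}$. Write $S=\{z_1<\dots<z_p\}$, $z_0=0$,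 $z_{p+1}=n$, and $[n-1]\setminus\mathrm{Des}_L(\sigma)=\{q_1<\dots<q_e\}$, $q_0=0$, $q_{e+1}=n$; $D_{\sigma;S}=\{(j,p+2-i):\{\sigma(r):z_{i-1}<r\le z_i\}\cap\{q_{j-1}+1,\dots,q_j\}\ne\emptyset\}$. *)

(* Defs.v *)
From HB Require Import structures.
From mathcomp Require Import all_boot all_order all_algebra all_fingroup.
From mathcomp Require Import generic_quotient zify boolp reals complex finmap.

Set Implicit Arguments.
Unset Strict Implicit.
Unset Printing Implicit Defensive.

Import GRing.Theory.

Local Open Scope nat_scope.

Section Permutations.

Variable n : nat.
Implicit Types (i j : 'I_n.-1) (x y : 'I_n) (S T : {set 'I_n.-1}).
Implicit Types (sigma tau rho gamma : 'S_n).

(* perm.v multiplies permutations from left to right. *)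
Definition pcomp sigma tau : 'S_n := (tau * sigma)%g.

Lemma ord_lo_subproof i : i < n.
Proof. by have := ltn_ord i; lia. Qed.

Lemma ord_hi_subproof i : i.+1 < n.
Proof. by have := ltn_ord i; lia. Qed.

Definition ord_lo i : 'I_n := Ordinal (ord_lo_subproof i).
Definition ord_hi i : 'I_n := Ordinal (ord_hi_subproof i).

(* Points of 'I_n stand for 1, ..., n and indices of 'I_n.-1 for 1, ..., n-1, *)
(* in both cases with a shift by one; thus sref i is s_(i+1) = (i+1, i+2).    *)
Definition sref i : 'S_n := tperm (ord_lo i) (ord_hi i).

Definition wprod (w : seq 'I_n.-1) : 'S_n := foldr (fun i => pcomp (sref i)) 1%g w.

Definition ninv sigma : nat :=
  #|[set p : 'I_n * 'I_n | (p.1 < p.2) && (sigma p.2 < sigma p.1)]|.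

Lemma val_s i x :
  val (sref i x) = if val x == i then i.+1 else if val x == i.+1 then val i else x.
Proof.
rewrite /sref permE /= -!val_eqE /=.
by case: eqP => // ?; case: eqP.
Qed.

Lemma pcompE sigma tau x : pcomp sigma tau x = sigma (tau x).
Proof. by rewrite permM. Qed.

Lemma pcomp_sK i : involutive (pcomp (sref i)).
Proof. by move=> g; rewrite /pcomp -mulgA tperm2 mulg1. Qed.

Lemma ninv_up i sigma : (sigma^-1)%g (ord_lo i) < (sigma^-1)%g (ord_hi i) ->
  ninv (pcomp (sref i) sigma) = (ninv sigma).+1.
Proof.
set a := (_ (ord_lo i)); set b := (_ (ord_hi i)) => ab.
have sa : sigma a = ord_lo i by rewrite permKV.
have sb : sigma b = ord_hi i by rewrite permKV.
rewrite /ninv.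
set A := [set _ | _]; set B := [set _ | _].
have -> : A = (a, b) |: B.
  apply/setP => -[x y]; rewrite !inE /= !pcompE xpair_eqE.
  have pos (z k : 'I_n) : z = (sigma^-1)%g k :> nat <-> sigma z = k :> nat.
    by split=> /val_inj => [->|<-]; rewrite ?permKV ?permK.
  have := (pos x (ord_lo i), pos x (ord_hi i), pos y (ord_lo i), pos y (ord_hi i)).
  rewrite -/a -/b -!val_eqE !val_s /= => -[[[xa xb] ya] yb].
  have ne : sigma x = sigma y :> nat -> x = y :> nat by move/val_inj/perm_inj->.
  move: (nat_of_ord (sigma x)) (nat_of_ord (sigma y)) xa xb ya yb ne => u v.
  have dec (P Q : Prop) : P <-> Q -> P /\ Q \/ ~ P /\ ~ Q.
    by case=> pq qp; have [p|np] := EM P; [left | right]; split; auto.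
  by do 4!move=> /dec[] [? ?]; move=> ?; do 4?case: eqP => ? //; lia.
rewrite cardsU1 !inE /= sa sb /=.
by rewrite ab /=; have -> : (i.+1 < i) = false by lia.
Qed.

Lemma pcomp_s_inv i sigma x : ((pcomp (sref i) sigma)^-1)%g x = (sigma^-1)%g (sref i x).
Proof. by rewrite /pcomp invMg tpermV permM. Qed.

Lemma s_lo i : sref i (ord_lo i) = ord_hi i. Proof. exact: tpermL. Qed.
Lemma s_hi i : sref i (ord_hi i) = ord_lo i. Proof. exact: tpermR. Qed.

Lemma pos_neq i sigma :
  (sigma^-1)%g (ord_lo i) != (sigma^-1)%g (ord_hi i) :> nat.
Proof.
rewrite -[_ != _]/(_ != _ :> 'I_n) (inj_eq perm_inj) -val_eqE /=; lia.
Qed.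

Lemma ninv_down i sigma : (sigma^-1)%g (ord_hi i) < (sigma^-1)%g (ord_lo i) ->
  ninv sigma = (ninv (pcomp (sref i) sigma)).+1.
Proof.
move=> h; rewrite -[X in ninv X = _](pcomp_sK i); apply: ninv_up.
by rewrite !pcomp_s_inv s_lo s_hi.
Qed.

Lemma no_descent_id sigma :
  (forall i, (sigma^-1)%g (ord_lo i) < (sigma^-1)%g (ord_hi i)) -> sigma = 1%g.
Proof.
move=> h; suff : (sigma^-1 = 1)%g by move/(congr1 invg); rewrite invgK invg1.
set tau := (sigma^-1)%g in h *.
have mono k x : x = k :> nat -> k <= tau x.
  elim: k x => // k IH x xk.
  have kn' : k < n.-1 by have := ltn_ord x; lia.
  have -> : x = ord_hi (Ordinal kn') by exact: val_inj.
  exact: leq_ltn_trans (IH (ord_lo (Ordinal kn')) erefl) (h _).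
have mono2 d x : n - x <= d.+1 -> tau x <= x.
  elim: d x => [|d IH] x dk.
    by rewrite -ltnS; apply: leq_trans (ltn_ord _) _; lia.
  case: (ltnP x n.-1) => [kn'|]; last first.
    by move=> ?; rewrite -ltnS; apply: leq_trans (ltn_ord _) _; lia.
  have -> : x = ord_lo (Ordinal kn') by exact: val_inj.
  have /= le := IH (ord_hi (Ordinal kn')) ltac:(rewrite /=; lia).
  by rewrite -ltnS /=; apply: leq_trans (h _) le.
apply/permP => x; rewrite perm1; apply: val_inj => /=.
by have := mono x x erefl; have := mono2 n x ltac:(lia); lia.
Qed.

Lemma ninv1 : ninv 1%g = 0.
Proof.
apply/eqP; rewrite cards_eq0; apply/eqP/setP => -[x y].
by rewrite !inE !perm1 /=; lia.
Qed.

Lemma wprod_ninv_ex sigma :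
  exists2 w, size w = ninv sigma & wprod w = sigma.
Proof.
move: {2}(ninv sigma) (erefl (ninv sigma)) => m.
elim: m sigma => [|m IH] sigma e.
  exists [::] => //=; apply/esym/no_descent_id => i.
  case: ltngtP (pos_neq i sigma) => // lt _.
  by have := ninv_down lt; lia.
have [/forallP h|] := boolP
    [forall i, (sigma^-1)%g (ord_lo i) < (sigma^-1)%g (ord_hi i)].
  by move: e; rewrite (no_descent_id h) ninv1.
rewrite negb_forall => /existsP [i hi].
have lt : (sigma^-1)%g (ord_hi i) < (sigma^-1)%g (ord_lo i).
  by have := pos_neq i sigma; lia.
have [|w sw pw] := IH (pcomp (sref i) sigma); first by have := ninv_down lt; lia.
by exists (i :: w); rewrite /= ?sw ?pw ?pcomp_sK; [have := ninv_down lt; lia|].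
Qed.

Lemma len_subproof sigma :
  exists k, [exists w : k.-tuple 'I_n.-1, wprod w == sigma].
Proof.
have [w _ pw] := wprod_ninv_ex sigma.
by exists (size w); apply/existsP; exists (in_tuple w); apply/eqP.
Qed.

Definition len sigma : nat := ex_minn (len_subproof sigma).

Definition DesL sigma : {set 'I_n.-1} :=
  [set i | len (pcomp (sref i) sigma) < len sigma].

Lemma ninv_s_le i sigma : ninv (pcomp (sref i) sigma) <= (ninv sigma).+1.
Proof.
have [lt|lt] := ltnP ((sigma^-1)%g (ord_lo i)) ((sigma^-1)%g (ord_hi i)).
  by rewrite ninv_up.
have lt' : (sigma^-1)%g (ord_hi i) < (sigma^-1)%g (ord_lo i).
  by have := pos_neq i sigma; lia.
by have := ninv_down lt'; lia.
Qed.

Lemma lenE sigma : len sigma = ninv sigma.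
Proof.
rewrite /len; case: ex_minnP => k /existsP [w /eqP pw] mink.
apply/eqP; rewrite eqn_leq; apply/andP; split.
  have [w' sw' pw'] := wprod_ninv_ex sigma.
  rewrite -sw'; apply: mink; apply/existsP; exists (in_tuple w').
  exact/eqP.
rewrite -pw -[X in _ <= X](size_tuple w); elim: (tval w) => [|i v IH] /=.
  by rewrite ninv1.
by apply: leq_trans (ninv_s_le _ _) _; rewrite ltnS.
Qed.

Lemma DesLE i sigma :
  (i \in DesL sigma) = ((sigma^-1)%g (ord_hi i) < (sigma^-1)%g (ord_lo i)).
Proof.
rewrite inE !lenE; case: ltnP => lt.
  apply/esym; case: ltngtP (pos_neq i sigma) => // lt' _.
  by have := ninv_up lt'; lia.
case: ltngtP (pos_neq i sigma) => // lt' _.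
by have := ninv_down lt'; lia.
Qed.

Definition leL : rel 'S_n :=
  connect [rel sigma tau | [exists i, (i \notin DesL sigma)
                                      && (tau == pcomp (sref i) sigma)]].

Definition intervalL sigma rho : {set 'S_n} :=
  [set gamma | leL sigma gamma && leL gamma rho].

Lemma leL_s i sigma : i \notin DesL sigma -> leL sigma (pcomp (sref i) sigma).
Proof.
by move=> h; apply: connect1; apply/existsP; exists i; rewrite h eqxx.
Qed.

Definition w0 S : 'S_n :=
  [arg max_(w > 1%g in <<[set sref i | i in S]>>%g) len w].

Definition w1 S : 'S_n := pcomp (w0 [set: 'I_n.-1]) (w0 (~: S)).

(* The word of sigma is sigma(1) ... sigma(n); any list that is not such a    *)
(* word is sent to 1.                                                         *)
Definition word sigma : seq nat := [seq (val (sigma x)).+1 | x <- enum 'I_n].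

Definition perm_of_word (w : seq nat) : 'S_n :=
  odflt 1%g [pick sigma | word sigma == w].

Definition set_of_comp (alpha : seq nat) : {set 'I_n.-1} :=
  [set i : 'I_n.-1 |
    i.+1 \in [seq sumn (take k alpha) | k <- iota 1 (size alpha).-1]].

End Permutations.

Section Steps.

Variable n : nat.
Implicit Types (i j : 'I_n.-1) (gamma : 'S_n) (I : {set 'S_n}).

Definition convexL I :=
  forall x y z, x \in I -> z \in I -> leL x y -> leL y z -> y \in I.

Lemma convex_intervalL sigma rho : convexL (@intervalL n sigma rho).
Proof.
move=> x y z; rewrite !inE => /andP [sx _] /andP [_ zr] xy yz; apply/andP; split.
  exact: connect_trans sx xy.
exact: connect_trans yz zr.
Qed.

Definition step I i gamma : option 'S_n :=
  if i \in DesL gamma then Some gamma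
  else if pcomp (sref i) gamma \in I then Some (pcomp (sref i) gamma) else None.

Definition desc i gamma : bool :=
  (gamma^-1)%g (ord_hi i) < (gamma^-1)%g (ord_lo i).

Lemma stepE I i gamma : step I i gamma =
  if desc i gamma then Some gamma
  else if pcomp (sref i) gamma \in I then Some (pcomp (sref i) gamma) else None.
Proof. by rewrite /step DesLE. Qed.

Lemma leL_desc i gamma : ~~ desc i gamma -> leL gamma (pcomp (sref i) gamma).
Proof. by rewrite /desc -DesLE; apply: leL_s. Qed.

Lemma s_far i (x : 'I_n) : x != i :> nat -> x != i.+1 :> nat -> sref i x = x.
Proof. by move=> h1 h2; rewrite /sref tpermD // -val_eqE /= eq_sym. Qed.

Lemma desc_s i gamma : desc i (pcomp (sref i) gamma) = ~~ desc i gamma.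
Proof.
by rewrite /desc !pcomp_s_inv s_lo s_hi; have := pos_neq i gamma; lia.
Qed.

Section Far.

Variables (i j : 'I_n.-1) (ij : i.+1 < j).

Lemma s_far_lo : sref i (ord_lo j) = ord_lo j.
Proof. by apply: s_far => /=; lia. Qed.

Lemma s_far_hi : sref i (ord_hi j) = ord_hi j.
Proof. by apply: s_far => /=; lia. Qed.

Lemma desc_far1 gamma : desc i (pcomp (sref j) gamma) = desc i gamma.
Proof.
by rewrite /desc !pcomp_s_inv !s_far //=; lia.
Qed.

Lemma desc_far2 gamma : desc j (pcomp (sref i) gamma) = desc j gamma.
Proof. by rewrite /desc !pcomp_s_inv s_far_lo s_far_hi. Qed.

Lemma pcomp_s_comm gamma :
  pcomp (sref i) (pcomp (sref j) gamma) = pcomp (sref j) (pcomp (sref i) gamma).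
Proof.
have /conjg_fixP/commgP c : (sref j ^ sref i = sref j)%g.
  by rewrite {1}/sref tpermJ s_far_lo s_far_hi.
by rewrite /pcomp -!mulgA; congr (_ * _)%g; apply: c.
Qed.

End Far.

Section Near.

Variables (i j : 'I_n.-1) (ij : j = i.+1 :> nat).

Lemma near_lo : ord_lo j = ord_hi i. Proof. exact: val_inj. Qed.

Lemma s_near : (sref i (ord_hi j) = ord_hi j) * (sref j (ord_lo i) = ord_lo i)
             * (sref j (ord_hi i) = ord_hi j) * (sref j (ord_hi j) = ord_hi i).
Proof.
rewrite -near_lo s_lo s_hi; do !split; rewrite // s_far //=; lia.
Qed.

Lemma pcomp_s_braid gamma :
  pcomp (sref i) (pcomp (sref j) (pcomp (sref i) gamma))
  = pcomp (sref j) (pcomp (sref i) (pcomp (sref j) gamma)).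
Proof.
have : (sref j ^ sref i = sref i ^ sref j)%g.
  by rewrite {1}/sref {2}/sref !tpermJ near_lo s_hi !s_near.
by rewrite !conjgE !tpermV /pcomp -!mulgA => ->.
Qed.

Lemma near_neq gamma : (gamma^-1)%g (ord_lo i) != (gamma^-1)%g (ord_hi j) :> nat.
Proof.
by rewrite -[_ != _]/(_ != _ :> 'I_n) (inj_eq perm_inj) -val_eqE /=; lia.
Qed.

Definition desc_near gamma :=
  (gamma^-1)%g (ord_hi j) < (gamma^-1)%g (ord_lo i).

Lemma desc_near_ij gamma : desc i (pcomp (sref j) gamma) = desc_near gamma.
Proof. by rewrite /desc !pcomp_s_inv !s_near. Qed.

Lemma desc_near_ji gamma : desc j (pcomp (sref i) gamma) = desc_near gamma.
Proof. by rewrite /desc !pcomp_s_inv near_lo s_hi !s_near. Qed.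

Lemma desc_near_i gamma : desc_near (pcomp (sref i) gamma) = desc j gamma.
Proof. by rewrite /desc /desc_near !pcomp_s_inv s_lo !s_near near_lo. Qed.

Lemma desc_near_j gamma : desc_near (pcomp (sref j) gamma) = desc i gamma.
Proof. by rewrite /desc /desc_near !pcomp_s_inv !s_near. Qed.

Lemma desc_near_lt gamma :
  (desc i gamma -> desc j gamma -> desc_near gamma) /\
  (~~ desc i gamma -> ~~ desc j gamma -> ~~ desc_near gamma).
Proof.
rewrite /desc /desc_near near_lo.
by have := pos_neq i gamma; have := pos_neq j gamma; rewrite near_lo; lia.
Qed.

End Near.

Local Opaque desc desc_near pcomp sref leL.

Lemma step_idem I i gamma : obind (step I i) (step I i gamma) = step I i gamma.
Proof.
rewrite stepE; case D: (desc i gamma) => /=; first by rewrite stepE D.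
by case: ifP => //= _; rewrite stepE desc_s D.
Qed.

Lemma step_comm I i j gamma : convexL I -> gamma \in I -> i.+1 < j ->
  obind (step I i) (step I j gamma) = obind (step I j) (step I i gamma).
Proof.
move=> cI gI ij.
have Di g := desc_far1 ij g; have Dj g := desc_far2 ij g.
have cm := pcomp_s_comm ij gamma.
have h1 : ~~ desc i gamma -> ~~ desc j gamma ->
    pcomp (sref j) (pcomp (sref i) gamma) \in I -> pcomp (sref i) gamma \in I.
  move=> hi hj TI; apply: (cI _ _ _ gI TI (leL_desc hi)).
  by apply: leL_desc; rewrite Dj.
have h2 : ~~ desc i gamma -> ~~ desc j gamma ->
    pcomp (sref j) (pcomp (sref i) gamma) \in I -> pcomp (sref j) gamma \in I.
  move=> hi hj; rewrite -cm => TI; apply: (cI _ _ _ gI TI (leL_desc hj)).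
  by apply: leL_desc; rewrite Di.
rewrite (stepE I j gamma) (stepE I i gamma).
case DI: (desc i gamma) h1 h2; case DJ: (desc j gamma) => /= h1 h2.
- by rewrite !stepE DI DJ.
- by rewrite stepE DJ; case: ifP => //= _; rewrite stepE Di DI.
- by rewrite stepE DI; case: ifP => //= _; rewrite stepE Dj DJ.
case jI: (pcomp (sref j) gamma \in I) h2 => /= h2;
  case iI: (pcomp (sref i) gamma \in I) h1 => /= h1;
  rewrite ?stepE ?Di ?Dj ?DI ?DJ ?cm //.
- by case: ifP => // /h1-/(_ isT isT).
- by case: ifP => // /h2-/(_ isT isT).
Qed.

Lemma step_braid I i j gamma : convexL I -> gamma \in I -> j = i.+1 :> nat ->
  obind (step I i) (obind (step I j) (step I i gamma))
  = obind (step I j) (obind (step I i) (step I j gamma)).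
Proof.
move=> cI gI ij.
have DE := (desc_s, desc_near_ij ij, desc_near_ji ij, desc_near_i ij, desc_near_j ij).
have br := pcomp_s_braid ij gamma.
have up k l m : ~~ desc k gamma -> ~~ desc l (pcomp (sref k) gamma) ->
    ~~ desc m (pcomp (sref l) (pcomp (sref k) gamma)) ->
    pcomp (sref m) (pcomp (sref l) (pcomp (sref k) gamma)) \in I ->
    (pcomp (sref k) gamma \in I) /\ (pcomp (sref l) (pcomp (sref k) gamma) \in I).
  move=> /leL_desc kD /leL_desc lD /leL_desc mD TI; split.
    by apply: (cI _ _ _ gI TI kD); apply: connect_trans lD mD.
  by apply: (cI _ _ _ gI TI _ mD); apply: connect_trans kD lD.
have := up i j i; have := up j i j; rewrite br !DE {up}.
have [] := desc_near_lt ij gamma.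
rewrite (stepE I i gamma) (stepE I j gamma).
case Di: (desc i gamma); case Dj: (desc j gamma); case Dn: (desc_near i j gamma) => /=;
  try (by move=> h; have := h isT isT); try (by move=> _ h; have := h isT isT);
  move=> _ _ upj upi.
all: repeat first [rewrite stepE /= | rewrite DE | rewrite Di | rewrite Dj
  | rewrite Dn | rewrite br | case: ifP => ? /= | progress move=> /=].
all: try by [].
all: first [ by have [] := upi isT isT isT ltac:(assumption); congruence
           | by have [] := upj isT isT isT ltac:(assumption); congruence ].
Qed.

End Steps.

Local Open Scope ring_scope.
Local Open Scope quotient_scope.

Section HeckeAlgebra.

Variables (K : fieldType) (n : nat).

Inductive hterm : Type :=
  | HGen of 'I_n.-1
  | HScal of K
  | HAdd of hterm & hterm
  | HMul of hterm & hterm.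

(* The least congruence that makes the terms an associative unital K-algebra  *)
(* in which the generators satisfy the relations of H_n(0).                   *)
Inductive heqv : hterm -> hterm -> Prop :=
  | heqv_refl t : heqv t t
  | heqv_sym t u : heqv t u -> heqv u t
  | heqv_trans t u v : heqv t u -> heqv u v -> heqv t v
  | heqv_add t t' u u' : heqv t t' -> heqv u u' -> heqv (HAdd t u) (HAdd t' u')
  | heqv_mul t t' u u' : heqv t t' -> heqv u u' -> heqv (HMul t u) (HMul t' u')
  | heqv_addA t u v : heqv (HAdd t (HAdd u v)) (HAdd (HAdd t u) v)
  | heqv_addC t u : heqv (HAdd t u) (HAdd u t)
  | heqv_add0 t : heqv (HAdd (HScal 0) t) t
  | heqv_addN t : heqv (HAdd (HMul (HScal (-1)) t) t) (HScal 0)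
  | heqv_mulA t u v : heqv (HMul t (HMul u v)) (HMul (HMul t u) v)
  | heqv_mul1l t : heqv (HMul (HScal 1) t) t
  | heqv_mul1r t : heqv (HMul t (HScal 1)) t
  | heqv_mulDl t u v : heqv (HMul (HAdd t u) v) (HAdd (HMul t v) (HMul u v))
  | heqv_mulDr t u v : heqv (HMul t (HAdd u v)) (HAdd (HMul t u) (HMul t v))
  | heqv_scalD a b : heqv (HScal (a + b)) (HAdd (HScal a) (HScal b))
  | heqv_scalM a b : heqv (HScal (a * b)) (HMul (HScal a) (HScal b))
  | heqv_scalC a t : heqv (HMul (HScal a) t) (HMul t (HScal a))
  | heqv_idem i : heqv (HMul (HGen i) (HGen i)) (HGen i)
  | heqv_braid (i j : 'I_n.-1) : j = i.+1 :> nat ->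
      heqv (HMul (HGen i) (HMul (HGen j) (HGen i)))
           (HMul (HGen j) (HMul (HGen i) (HGen j)))
  | heqv_comm (i j : 'I_n.-1) : (i.+1 < j)%N || (j.+1 < i)%N ->
      heqv (HMul (HGen i) (HGen j)) (HMul (HGen j) (HGen i)).

HB.instance Definition _ := gen_eqMixin hterm.
HB.instance Definition _ := gen_choiceMixin hterm.

Definition heqvb : rel hterm := fun t u => `[< heqv t u >].

Lemma heqvb_refl : reflexive heqvb.
Proof. by move=> t; apply/asboolP; constructor. Qed.

Lemma heqvb_sym : symmetric heqvb.
Proof. by move=> t u; apply/asboolP/asboolP; apply: heqv_sym. Qed.

Lemma heqvb_trans : transitive heqvb.
Proof. by move=> t u v /asboolP ut /asboolP tv; apply/asboolP/(heqv_trans ut). Qed.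

Canonical heqv_rel := EquivRel heqvb heqvb_refl heqvb_sym heqvb_trans.

Definition H0 : Type := {eq_quot heqv_rel}.

HB.instance Definition _ : EqQuotient hterm heqvb H0 := EqQuotient.on H0.
HB.instance Definition _ := Choice.on H0.

Definition hpi (t : hterm) : H0 := \pi_H0 t.

Lemma hpiP t u : heqv t u -> hpi t = hpi u.
Proof. by move=> e; apply/eqquotP/asboolP. Qed.

Lemma heqv_repr t : heqv (repr (hpi t)) t.
Proof.
by apply/asboolP/(@eqquotP _ _ H0); rewrite reprK.
Qed.

Lemma hpi_ind (P : H0 -> Prop) : (forall t, P (hpi t)) -> forall x, P x.
Proof. by move=> h x; rewrite -[x]reprK; apply: h. Qed.

Definition hadd (x y : H0) : H0 := hpi (HAdd (repr x) (repr y)).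
Definition hmul (x y : H0) : H0 := hpi (HMul (repr x) (repr y)).
Definition hscal (a : K) : H0 := hpi (HScal a).
Definition hopp (x : H0) : H0 := hmul (hscal (-1)) x.

Lemma haddE t u : hadd (hpi t) (hpi u) = hpi (HAdd t u).
Proof. by apply: hpiP; apply: heqv_add; apply: heqv_repr. Qed.

Lemma hmulE t u : hmul (hpi t) (hpi u) = hpi (HMul t u).
Proof. by apply: hpiP; apply: heqv_mul; apply: heqv_repr. Qed.

Lemma haddA : associative hadd.
Proof.
by elim/hpi_ind=> x; elim/hpi_ind=> y; elim/hpi_ind=> z; rewrite !haddE; apply: hpiP; constructor.
Qed.

Lemma haddC : commutative hadd.
Proof.
by elim/hpi_ind=> x; elim/hpi_ind=> y; rewrite !haddE; apply: hpiP; constructor.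
Qed.

Lemma hadd0 : left_id (hscal 0) hadd.
Proof. by elim/hpi_ind=> x; rewrite haddE; apply: hpiP; constructor. Qed.

Lemma haddN : left_inverse (hscal 0) hopp hadd.
Proof. by elim/hpi_ind=> x; rewrite /hopp hmulE haddE; apply: hpiP; constructor. Qed.

HB.instance Definition _ := GRing.isZmodule.Build H0 haddA haddC hadd0 haddN.

Lemma hmulA : associative hmul.
Proof.
by elim/hpi_ind=> x; elim/hpi_ind=> y; elim/hpi_ind=> z; rewrite !hmulE; apply: hpiP; constructor.
Qed.

Lemma hmul1l : left_id (hscal 1) hmul.
Proof. by elim/hpi_ind=> x; rewrite hmulE; apply: hpiP; constructor. Qed.

Lemma hmul1r : right_id (hscal 1) hmul.
Proof. by elim/hpi_ind=> x; rewrite hmulE; apply: hpiP; constructor. Qed.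

Lemma hmulDl : left_distributive hmul hadd.
Proof.
elim/hpi_ind=> x; elim/hpi_ind=> y; elim/hpi_ind=> z.
by rewrite haddE !hmulE haddE; apply: hpiP; constructor.
Qed.

Lemma hmulDr : right_distributive hmul hadd.
Proof.
elim/hpi_ind=> x; elim/hpi_ind=> y; elim/hpi_ind=> z.
by rewrite haddE !hmulE haddE; apply: hpiP; constructor.
Qed.

Section Action.

Variables (V : lmodType K) (op : 'I_n.-1 -> V -> V).

Definition H0_relations : Prop :=
  [/\ forall i, linear (op i),
      forall i v, op i (op i v) = op i v,
      forall (i j : 'I_n.-1) v, j = i.+1 :> nat ->
        op i (op j (op i v)) = op j (op i (op j v))
    & forall (i j : 'I_n.-1) v, (i.+1 < j)%N || (j.+1 < i)%N ->
        op i (op j v) = op j (op i v)].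

Fixpoint term_act (t : hterm) (v : V) : V :=
  match t with
  | HGen i => op i v
  | HScal a => a *: v
  | HAdd t u => term_act t v + term_act u v
  | HMul t u => term_act t (term_act u v)
  end.

Hypothesis opP : H0_relations.

Lemma term_act_linear t : linear (term_act t).
Proof.
have [opl _ _ _] := opP.
elim: t => [i|a|t IHt u IHu|t IHt u IHu] c x y /=.
- exact: opl.
- by rewrite scalerDr !scalerA mulrC.
- by rewrite IHt IHu scalerDr addrACA.
- by rewrite IHu IHt.
Qed.

Lemma term_actZ t a v : term_act t (a *: v) = a *: term_act t v.
Proof.
have h := term_act_linear t; have h0 : term_act t 0 = 0.
  by have := h (-1) 0 0; rewrite scaleN1r oppr0 addr0 scaleN1r addNr.
by have := h a v 0; rewrite !addr0 h0 addr0.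
Qed.

Lemma term_actD t u v : term_act t (u + v) = term_act t u + term_act t v.
Proof. by have := term_act_linear t 1 u v; rewrite !scale1r. Qed.

Lemma term_act_eqv t u : heqv t u -> term_act t =1 term_act u.
Proof.
have [_ opi opb opc] := opP.
elim=> {t u} /=.
- by [].
- by move=> t u _ IH v; rewrite IH.
- by move=> t u v _ IH1 _ IH2 x; rewrite IH1 IH2.
- by move=> t t' u u' _ IH1 _ IH2 x; rewrite IH1 IH2.
- by move=> t t' u u' _ IH1 _ IH2 x; rewrite IH2 IH1.
- by move=> t u v x; rewrite addrA.
- by move=> t u x; rewrite addrC.
- by move=> t x; rewrite scale0r add0r.
- by move=> t x; rewrite scaleN1r addNr scale0r.
- by [].
- by move=> t x; rewrite scale1r.
- by move=> t x; rewrite scale1r.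
- by [].
- by move=> t u v x; rewrite term_actD.
- by move=> a b x; rewrite scalerDl.
- by move=> a b x; rewrite scalerA.
- by move=> a t x; rewrite term_actZ.
- by move=> i x; apply: opi.
- by move=> i j ij x; apply: opb.
- by move=> i j ij x; apply: opc.
Qed.

Definition H0_act (x : H0) : V -> V := term_act (repr x).

Lemma H0_actE t v : H0_act (hpi t) v = term_act t v.
Proof. by apply: term_act_eqv; apply: heqv_repr. Qed.

End Action.

Lemma hone_neq0 : hscal 1 != 0.
Proof.
apply/eqP => e.
pose op (_ : 'I_n.-1) (v : K^o) : K^o := 0.
have opP : H0_relations op.
  by split=> //; move=> i a x y; rewrite /op scaler0 addr0.
have : H0_act op (hscal 1) 1 = H0_act op (hscal 0) 1 by rewrite e.
rewrite !H0_actE //= scale1r scale0r => /eqP.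
by rewrite oner_eq0.
Qed.

HB.instance Definition _ := GRing.Zmodule_isNzRing.Build H0
  hmulA hmul1l hmul1r hmulDl hmulDr hone_neq0.

Lemma hscalM a b : hscal (a * b) = hscal a * hscal b.
Proof. by rewrite [RHS]hmulE; apply: hpiP; constructor. Qed.

Lemma hscalD a b : hscal (a + b) = hscal a + hscal b.
Proof. by rewrite [RHS]haddE; apply: hpiP; constructor. Qed.

Lemma hscalC a x : hscal a * x = x * hscal a.
Proof.
elim/hpi_ind: x => x; rewrite [LHS]hmulE [RHS]hmulE.
by apply: hpiP; constructor.
Qed.

Let hscale a (x : H0) : H0 := hscal a * x.

Lemma hscaleA a b x : hscale a (hscale b x) = hscale (a * b) x.
Proof. by rewrite /hscale mulrA -hscalM. Qed.

Lemma hscale1 : left_id 1 hscale.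
Proof. exact: mul1r. Qed.

Lemma hscaleDr : right_distributive hscale +%R.
Proof. by move=> a x y; apply: mulrDr. Qed.

Lemma hscaleDl x : {morph hscale^~ x : a b / a + b}.
Proof. by move=> a b; rewrite /hscale hscalD mulrDl. Qed.

HB.instance Definition _ := GRing.Zmodule_isLmodule.Build K H0
  hscaleA hscale1 hscaleDr hscaleDl.

Lemma hscaleAl (a : K) (x y : H0) : a *: (x * y) = (a *: x) * y.
Proof. exact: mulrA. Qed.

HB.instance Definition _ := GRing.Lmodule_isLalgebra.Build K H0 hscaleAl.

Lemma hscaleAr (a : K) (x y : H0) : a *: (x * y) = x * (a *: y).
Proof.
by rewrite hscaleAl -[a *: x]/(hscal a * x) hscalC -mulrA.
Qed.

HB.instance Definition _ := GRing.Lalgebra_isAlgebra.Build K H0 hscaleAr.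

Definition H0gen (i : 'I_n.-1) : H0 := hpi (HGen i).

Lemma H0gen_idem i : H0gen i * H0gen i = H0gen i.
Proof. by rewrite [LHS]hmulE; apply: hpiP; constructor. Qed.

Lemma H0gen_braid (i j : 'I_n.-1) : j = i.+1 :> nat ->
  H0gen i * H0gen j * H0gen i = H0gen j * H0gen i * H0gen j.
Proof.
move=> ij; rewrite -!mulrA [X in _ * X]hmulE [LHS]hmulE.
by rewrite [X in _ = _ * X]hmulE [RHS]hmulE; apply: hpiP; constructor.
Qed.

Lemma H0gen_comm (i j : 'I_n.-1) : (i.+1 < j)%N || (j.+1 < i)%N ->
  H0gen i * H0gen j = H0gen j * H0gen i.
Proof.
by move=> ij; rewrite [LHS]hmulE [RHS]hmulE; apply: hpiP; constructor.
Qed.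

End HeckeAlgebra.

(* The H_n(0)-module on a K-vector space V in which pi_i acts by op i.        *)
Definition hmod (K : fieldType) (n : nat) (V : lmodType K)
  (op : 'I_n.-1 -> V -> V) (opP : H0_relations op) : Type := V.

Section HeckeModule.

Variables (K : fieldType) (n : nat) (V : lmodType K) (op : 'I_n.-1 -> V -> V).
Hypothesis opP : H0_relations op.

HB.instance Definition _ := GRing.Zmodule.on (hmod opP).

Let act (x : H0 K n) (v : hmod opP) : hmod opP := H0_act op x v.

Lemma hmod_actA x y v : act x (act y v) = act (x * y) v.
Proof.
elim/hpi_ind: x => x; elim/hpi_ind: y => y.
by rewrite [hpi x * hpi y]hmulE /act !H0_actE.
Qed.

Lemma hmod_act1 : left_id 1 act.
Proof. by move=> v; rewrite /act [LHS]H0_actE //= scale1r. Qed.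

Lemma hmod_actDr : right_distributive act +%R.
Proof. by elim/hpi_ind=> x u v; rewrite /act !H0_actE // term_actD. Qed.

Lemma hmod_actDl v : {morph act^~ v : x y / x + y}.
Proof.
elim/hpi_ind=> x; elim/hpi_ind=> y.
by rewrite [hpi x + hpi y]haddE /act !H0_actE.
Qed.

HB.instance Definition _ := GRing.Zmodule_isLmodule.Build (H0 K n) (hmod opP)
  hmod_actA hmod_act1 hmod_actDr hmod_actDl.

Lemma hmod_genE i (v : hmod opP) : H0gen K i *: v = op i v.
Proof. exact: H0_actE. Qed.

Lemma hmod_scalE (a : K) (v : hmod opP) :
  a%:A *: v = (a *: (v : V)) :> V.
Proof. by rewrite -[a%:A]/(hscal n a * 1) mulr1; exact: H0_actE. Qed.

End HeckeModule.

Section IntervalModule.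

Variables (K : fieldType) (n : nat) (I : {set 'S_n}).

Let V := {ffun {gamma : 'S_n | gamma \in I} -> K^o}.

Definition Bvec (g : 'S_n) : V := [ffun x => (val x == g)%:R].

Definition Bpi (i : 'I_n.-1) (f : V) : V :=
  \sum_(x : {gamma : 'S_n | gamma \in I}) f x *:
    (if i \in DesL (val x) then Bvec (val x)
     else if pcomp (sref i) (val x) \in I then Bvec (pcomp (sref i) (val x))
     else 0).

Lemma Bpi_linear i : linear (Bpi i).
Proof.
move=> a f g; rewrite /Bpi scaler_sumr -big_split; apply: eq_bigr => x _ /=.
by rewrite !ffunE scalerA -scalerDl.
Qed.

Lemma Bvec_basis (f : V) : f = \sum_x f x *: Bvec (val x).
Proof.
apply/ffunP => y; rewrite sum_ffunE (bigD1 y) //= big1 ?addr0.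
  by rewrite !ffunE eqxx [_ *: _]mulr1.
by move=> x xy; rewrite !ffunE val_eqE eq_sym (negPf xy) scaler0.
Qed.

Lemma Bpi_vec i (g : 'S_n) : g \in I -> Bpi i (Bvec g) = oapp Bvec 0 (step I i g).
Proof.
move=> gI; rewrite /Bpi (bigD1 (exist _ g gI)) //= big1 ?addr0.
  by rewrite !ffunE eqxx scale1r /step; do 2 case: ifP => //.
move=> x xg; rewrite ffunE.
by have /negPf -> : val x != g by []; rewrite scale0r.
Qed.

Lemma step_in i g h : g \in I -> step I i g = Some h -> h \in I.
Proof. by move=> gI; rewrite /step; case: ifP => [_ [<-] //|_]; case: ifP => // hI [<-]. Qed.

Let oin (o : option 'S_n) := forall g, o = Some g -> g \in I.

Lemma oin_step i o : oin o -> oin (obind (step I i) o).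
Proof. by case: o => [g|] //= h g' /step_in; apply; apply: h. Qed.

Lemma Bpi_oapp i o : oin o -> Bpi i (oapp Bvec 0 o) = oapp Bvec 0 (obind (step I i) o).
Proof.
case: o => [g|] /= h; first by apply: Bpi_vec; apply: h.
by have := Bpi_linear i (-1) 0 0; rewrite scaler0 addr0 scaleN1r addNr.
Qed.

Lemma Bpi_ext (F G : V -> V) : linear F -> linear G ->
  (forall g, g \in I -> F (Bvec g) = G (Bvec g)) -> F =1 G.
Proof.
move=> Fl Gl FG f.
have ext (H : V -> V) : linear H -> H f = \sum_x f x *: H (Bvec (val x)).
  move=> Hl; have H0 : H 0 = 0.
    by have := Hl (-1) 0 0; rewrite scaler0 addr0 scaleN1r addNr.
  rewrite {1}[f]Bvec_basis; elim/big_ind2: _ => //.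
    by move=> u1 v1 u2 v2 <- <-; have := Hl 1 v1 v2; rewrite !scale1r.
  by move=> x _; have := Hl (f x) (Bvec (val x)) 0; rewrite H0 !addr0.
by rewrite !ext //; apply: eq_bigr => x _; rewrite FG //; apply: valP.
Qed.

Lemma comp_linear (F G : V -> V) : linear F -> linear G -> linear (F \o G).
Proof. by move=> Fl Gl a u v /=; rewrite Gl Fl. Qed.

Lemma Bpi_relations : convexL I -> H0_relations Bpi.
Proof.
move=> cI; have lin := Bpi_linear.
have lin2 i j := comp_linear (lin i) (lin j).
have lin3 i j k := comp_linear (lin i) (lin2 j k).
have sin i g : g \in I -> oin (step I i g) by move=> gI h /step_in; apply.
split=> //.
- move=> i; apply: (Bpi_ext (lin2 i i) (lin i)) => g gI /=.
  by rewrite Bpi_vec // Bpi_oapp ?step_idem //; apply: sin.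
- move=> i j v ij; move: v; apply: (Bpi_ext (lin3 i j i) (lin3 j i j)) => g gI /=.
  rewrite !Bpi_vec // !Bpi_oapp; first (by rewrite step_braid);
    by first [exact: sin | apply: oin_step; exact: sin].
- move=> i j v ij; move: v; apply: (Bpi_ext (lin2 i j) (lin2 j i)) => g gI /=.
  rewrite !Bpi_vec // !Bpi_oapp; try exact: sin.
  by case/orP: ij => ij; [rewrite step_comm | rewrite -step_comm].
Qed.

End IntervalModule.

Definition Bmod (K : fieldType) (n : nat) (sigma rho : 'S_n) : lmodType (H0 K n) :=
  hmod (Bpi_relations K (@convex_intervalL n sigma rho)).

Section ModuleCategory.

Variable A : pzRingType.

Definition fin_gen (M : lmodType A) : Prop :=
  exists (k : nat) (g : 'I_k -> M),
    forall x, exists c : 'I_k -> A, x = \sum_i c i *: g i.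

Definition surjective (X Y : Type) (f : X -> Y) : Prop :=
  forall y, exists x, f x = y.

Definition injective_fg (E : lmodType A) : Prop :=
  forall (X Y : lmodType A) (f : {linear X -> Y}) (g : {linear X -> E}),
    fin_gen X -> fin_gen Y -> injective f ->
    exists h : {linear Y -> E}, forall x, h (f x) = g x.

Definition projective_fg (P : lmodType A) : Prop :=
  forall (X Y : lmodType A) (f : {linear X -> Y}) (g : {linear P -> Y}),
    fin_gen X -> fin_gen Y -> surjective f ->
    exists h : {linear P -> X}, forall x, f (h x) = g x.

Definition essential_mono (M E : lmodType A) (f : {linear M -> E}) : Prop :=
  injective f /\
  forall (X : lmodType A) (g : {linear E -> X}),
    fin_gen X -> injective (g \o f) -> injective g.

Definition essential_epi (P M : lmodType A) (f : {linear P -> M}) : Prop :=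
  surjective f /\
  forall (X : lmodType A) (g : {linear X -> P}),
    fin_gen X -> surjective (f \o g) -> surjective g.

Definition is_injective_hull (M E : lmodType A) : Prop :=
  [/\ fin_gen E, injective_fg E & exists f : {linear M -> E}, essential_mono f].

Definition is_projective_cover (M P : lmodType A) : Prop :=
  [/\ fin_gen P, projective_fg P & exists f : {linear P -> M}, essential_epi f].

End ModuleCategory.

Local Close Scope ring_scope.
Local Close Scope quotient_scope.
Local Open Scope fset_scope.

Section Diagrams.

(* Boxes are (column, row), both counted from 1; rows go up. *)
Implicit Type D : {fset nat * nat}.

Definition ncols D : nat := \max_(b <- D) b.1.
Definition nrows D : nat := \max_(b <- D) b.2.

Definition row_comp D : seq nat :=
  [seq count (fun b => b.2 == y) D | y <- rev (iota 1 (nrows D))].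

Definition col_comp D : seq nat :=
  [seq count (fun b => b.1 == x) D | x <- iota 1 (ncols D)].

Definition no_upper_right D : Prop :=
  ~ exists b1 b2, [/\ b1 \in D, b2 \in D, b1.1 < b2.1, b1.2 < b2.2
    & forall b, b \in D -> b1.1 <= b.1 <= b2.1 -> b1.2 <= b.2 <= b2.2 ->
        b = b1 \/ b = b2].

Definition order_down D : seq (nat * nat) :=
  [seq b <- [seq (x, y) | x <- iota 1 (ncols D), y <- rev (iota 1 (nrows D))]
  | b \in D].

Definition order_right D : seq (nat * nat) :=
  [seq b <- [seq (x, y) | y <- rev (iota 1 (nrows D)), x <- iota 1 (ncols D)]
  | b \in D].

Definition order_BL D : seq (nat * nat) :=
  [seq b <- [seq (x, y) | x <- iota 1 (ncols D), y <- iota 1 (nrows D)]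
  | b \in D].

Definition order_LB D : seq (nat * nat) :=
  [seq b <- [seq (x, y) | y <- iota 1 (nrows D), x <- iota 1 (ncols D)]
  | b \in D].

Definition F_down D (b : nat * nat) : nat := (index b (order_down D)).+1.
Definition F_right D (b : nat * nat) : nat := (index b (order_right D)).+1.

Definition w_BL D (F : nat * nat -> nat) : seq nat := map F (order_BL D).
Definition w_LB D (F : nat * nat -> nat) : seq nat := map F (order_LB D).

End Diagrams.

Section IntervalDiagrams.

Variable n : nat.
Implicit Types (S T : {set 'I_n.-1}) (sigma rho : 'S_n).

(* 0, z_1, ..., z_p, n, where T = {z_1 < ... < z_p}; enum on ordinals is      *)
(* increasing.                                                                *)
Definition cuts T : seq nat := 0 :: rcons [seq (val i).+1 | i <- enum T] n.

Definition in_block T (k : nat) (r : 'I_n) : bool :=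
  nth 0 (cuts T) k.-1 < r.+1 <= nth 0 (cuts T) k.

(* D_(S;rho) and D_(sigma;S). *)
Definition diagram_left S rho : {fset nat * nat} :=
  [fset b in [seq (i, j) | i <- iota 1 #|~: S|.+1, j <- iota 1 #|DesL rho|.+1]
  | [exists r : 'I_n, in_block (~: S) b.1 r && in_block (DesL rho) b.2 (rho r)]].

Definition diagram_right sigma S : {fset nat * nat} :=
  [fset (b.2, #|S| + 2 - b.1) | b in
    [seq (i, j) | i <- iota 1 #|S|.+1, j <- iota 1 #|~: DesL sigma|.+1]
  & [exists r : 'I_n, in_block S b.1 r && in_block (~: DesL sigma) b.2 (sigma r)]].

End IntervalDiagrams.

(* Main.v *)
(* The module on [w0 A, w1 T] is cyclic, generated by e = w0 A, with basis the *)
(* permutations whose right descent set lies between A and T. For the product  *)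
(* q of pi_(w0 A) and of the longest product of the 1 - pi_j, j not in T, the  *)
(* vector q e is e modulo the part spanned by the z whose support is not       *)
(* contained in T; that part lies in J e for a nilpotent ideal J. Hence e is   *)
(* a multiple q c e, which splits every surjection onto the module, and any    *)
(* quotient by a subspace of that part is essential.                           *)
(* When the diagram is free of strictly upper-right configurations, changing   *)
(* the reading order of its boxes is a right translation by some u that        *)
(* preserves left descents on the interval. The translate of [sigma, w1 S] is  *)
(* a lower interval [w0 A, rho u], that is, a quotient of the module on        *)
(* [w0 A, w1 T] with T the right descent set of rho u, and the kernel is       *)
(* spanned by z with support not contained in T. This is the projective cover. *)
(* Injective hulls follow by K-duality twisted by pi_i |-> 1 - pi_i, which     *)
(* sends the module on I to the one on I w0.                                   *)

From HB Require Import structures.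
Require Import Defs.
From mathcomp Require Import all_boot all_order all_algebra all_fingroup.
From mathcomp Require Import zify boolp reals complex finmap.
(* ssrfun also defines a pcomp *)
Import Defs.

Set Implicit Arguments.
Unset Strict Implicit.
Unset Printing Implicit Defensive.

Import GRing.Theory.

(** * The left weak order *)

(** By [leLP] the left weak order is containment of the sets of inverted position pairs; hence
    $[w_0(A),w_1(T)]_L$ consists of the permutations whose right descent set lies between $A$ and
    $T$ ([leL_w0], [leL_w1]).

    For the projective cover, positions are identified with boxes, and $[\sigma,w_1(S)]_L$ is
    translated on the right by [right_u], which moves its bottom to some $w_0(A)$. A left descent
    $i$ of $\gamma$ could change only if the values $i,i+1$ lay on a strictly upper-right pair of
    boxes. By hypothesis a third box lies in their rectangle, and $\gamma$ would have to take there
    a value strictly between $i$ and $i+1$ ([DesL_translate]). With descents preserved, the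
    translated interval $[w_0(A),w_1(S)u]_L$ gives a quotient of $E=\mathsf B([w_0(A),w_1(T)]_L)$,
    where $T$ is the right descent set of $w_1(S)u$.

    The module $E$ is cyclic on $e=w_0(A)$. It maps to any module containing a vector killed by all
    $\pi_j$, $j\notin T$ ([pi_Hom_gen]), and [q_top] makes enough of these maps available for
    lifting ([top_projective]). The kernel of the quotient map lies in the span of the $z$ whose
    support is not contained in $T$ ([quotient_ker]). Such vectors are $he$ with $h$ nilpotent on
    $E$ ([offT_raises]), so the map is essential ([top_essential]). This gives [interval_cover].

    The injective hull follows by duality: $K$-linear functionals, twisted by $\pi_i\mapsto
    1-\pi_i$, turn the module of $I$ into that of $Iw_0$ ([to_dual]), and exchange covers and hulls
    ([injective_hull_of_cover], [interval_hull]).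

    The end points are then matched with the diagram: reading words are quotients of two reading
    orders ([left_reading], [right_reading]), and partial sums of row or column sizes are cut points
    of blocks ([set_of_comp_down], [set_of_comp_up]). *)

Section WeakOrder.

Variable n : nat.
Implicit Types (i j k : 'I_n.-1) (p q x y : 'I_n) (A B S T : {set 'I_n.-1}).
Implicit Types (sigma tau rho gamma z u : 'S_n).

Definition DesR z : {set 'I_n.-1} := [set i | z (ord_hi i) < z (ord_lo i)].

Lemma DesLV z : DesL z^-1 = DesR z.
Proof. by apply/setP => i; rewrite DesLE invgK inE. Qed.

Lemma perm_val_eq z x y : (z x == z y :> nat) = (x == y :> nat).
Proof. by rewrite !val_eqE (inj_eq perm_inj). Qed.

Lemma perm_ltNge z x y : x != y :> nat -> (z x < z y) = ~~ (z y < z x).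
Proof. by rewrite -(perm_val_eq z); lia. Qed.

Lemma pcompV sigma tau : ((pcomp sigma tau)^-1 = pcomp tau^-1 sigma^-1)%g.
Proof. exact: invMg. Qed.

Lemma pcompA sigma tau rho : pcomp sigma (pcomp tau rho) = pcomp (pcomp sigma tau) rho.
Proof. by rewrite /pcomp mulgA. Qed.

Lemma step_lt (f : 'I_n -> nat) p q :
  (forall k, p <= k < q -> f (ord_lo k) < f (ord_hi k)) -> p < q -> f p < f q.
Proof.
move=> fk; move: {2}(q - p) (leqnn (q - p)) => d; elim: d q fk => [|d IH] q fk dq pq.
  lia.
have qn := ltn_ord q.
have q1 : q.-1 < n.-1 by lia.
have eq_hi : ord_hi (Ordinal q1) = q by apply: val_inj => /=; lia.
have := fk (Ordinal q1); rewrite eq_hi /=; set r := ord_lo _ => lt_r.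
have {}lt_r : f r < f q by apply: lt_r; lia.
have [e|ne] := eqVneq p r; first by rewrite e.
have pr : p < r by move: ne; rewrite -val_eqE /=; lia.
apply: ltn_trans lt_r; apply: IH => //=; last by lia.
by move=> k /= ?; apply: fk; lia.
Qed.

Lemma step_gt (f : 'I_n -> nat) p q :
  (forall k, p <= k < q -> f (ord_hi k) < f (ord_lo k)) -> p < q -> f q < f p.
Proof.
move=> fk pq; pose N := \max_x f x.
have fN x : f x <= N by apply: leq_bigmax.
have := @step_lt (fun x => N - f x) p q; rewrite pq => /(_ _ isT) h.
suff : N - f p < N - f q by have := fN p; have := fN q; lia.
by apply: h => k /fk; have := fN (ord_lo k); have := fN (ord_hi k); lia.
Qed.

Lemma perm_lt_inj sigma gamma :
  (forall x y, sigma x < sigma y -> gamma x < gamma y) -> sigma = gamma.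
Proof.
move=> h; suff e : (gamma^-1 * sigma = 1)%g by rewrite -[LHS](mulKVg gamma) e mulg1.
apply: no_descent_id => i; rewrite invMg invgK !permM; apply: h.
by rewrite !permKV /=.
Qed.


(** If no ascent of [sigma] were inverted in [gamma], then $\gamma\sigma^{-1}$ would increase along
    all adjacent values and so be the identity. *)
Lemma inv_step sigma gamma :
  (forall p q, p < q -> sigma q < sigma p -> gamma q < gamma p) -> sigma != gamma ->
  exists2 i, i \notin DesL sigma &
    gamma ((sigma^-1)%g (ord_hi i)) < gamma ((sigma^-1)%g (ord_lo i)).
Proof.
move=> sg ne; apply: contrapT => no; case/eqP: ne; apply: perm_lt_inj.
suff mono x y : x < y -> gamma ((sigma^-1)%g x) < gamma ((sigma^-1)%g y).
  by move=> x y /mono; rewrite !permK.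
apply: (@step_lt (fun x => gamma ((sigma^-1)%g x))) => k _; rewrite perm_ltNge; last first.
  by rewrite perm_val_eq /=; lia.
apply/negP => lt; apply: no; exists k => //; rewrite DesLE -leqNgt leqNgt.
by apply/negP => /sg; rewrite !permKV /= ltnSn => /(_ isT); lia.
Qed.

Lemma inv_s i gamma x y : i \notin DesL gamma -> x < y ->
  (pcomp (sref i) gamma y < pcomp (sref i) gamma x) =
  (gamma y < gamma x) || ((gamma x == ord_lo i) && (gamma y == ord_hi i)).
Proof.
rewrite DesLE -leqNgt => lo_hi xy; rewrite !pcompE !val_s.
have pos (z k : 'I_n) : (gamma z == k) = (z == (gamma^-1)%g k).
  by rewrite (can2_eq (permK gamma) (permKV gamma)).
have ne : ~~ ((gamma y == ord_lo i) && (gamma x == ord_hi i)).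
  rewrite !pos; apply/negP => /andP [/eqP eq /eqP ep].
  by move: lo_hi xy; rewrite eq ep; lia.
have gxy := perm_val_eq gamma x y.
have xy_ne : (val x == y) = false by apply: ltn_eqF.
move: ne gxy; rewrite -!val_eqE /= xy_ne.
move: (nat_of_ord (gamma x)) (nat_of_ord (gamma y)) => a b.
by case: (eqVneq a i) => ?; case: (eqVneq a i.+1) => ?;
   case: (eqVneq b i) => ?; case: (eqVneq b i.+1) => ?; lia.
Qed.

(** A cover $\sigma\prec s_i\sigma$ adds exactly one inverted pair of positions ([inv_s]).
    Conversely [inv_step] climbs one cover while staying inside the pairs inverted by [gamma]; the
    induction is on the room left below the bound $n^2$ for the length. *)
Lemma leLP sigma gamma :
  reflect (forall p q, p < q -> sigma q < sigma p -> gamma q < gamma p)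
          (leL sigma gamma).
Proof.
apply: (iffP idP) => [/connectP [s]|].
  elim: s sigma => [|tau s IH] sigma /=; first by move=> _ -> p q _.
  case/andP => /existsP [i /andP [iD /eqP ->]] /IH{}IH /IH{}IH p q pq sqp.
  by apply: IH => //; rewrite inv_s // sqp.
move: {2}(n * n - ninv sigma) (leqnn (n * n - ninv sigma)) => d.
have bound tau : ninv tau <= n * n.
  by rewrite /ninv; apply: leq_trans (max_card _) _; rewrite card_prod card_ord.
elim: d sigma => [|d IH] sigma ds sg.
all: have [->|ne] := eqVneq sigma gamma; first exact: connect0.
all: have [i iD lt] := inv_step sg ne.
all: have up := iD; rewrite DesLE -leqNgt leq_eqVlt (negPf (pos_neq _ _)) /= in up.
all: have {}up := ninv_up up; have le_bound := bound (pcomp (sref i) sigma).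
  by exfalso; lia.
apply: connect_trans (leL_s iD) _; apply: IH; first by lia.
move=> p q pq; rewrite inv_s // => /orP [/(sg _ _ pq) -> //|/andP [/eqP ep /eqP eq]].
by move: lt; rewrite -ep -eq !permK.
Qed.

Lemma leL_refl sigma : leL sigma sigma. Proof. exact: connect0. Qed.

Lemma leL_trans tau sigma rho : leL sigma tau -> leL tau rho -> leL sigma rho.
Proof. exact: connect_trans. Qed.

Lemma leL_anti sigma tau : leL sigma tau -> leL tau sigma -> sigma = tau.
Proof.
move=> /leLP st /leLP ts; apply: perm_lt_inj => x y.
case: (ltngtP x y) => [xy|yx|/val_inj ->]; last by lia.
  rewrite (perm_ltNge _ (x := x)) ?ltn_eqF // => /negP h.
  by rewrite perm_ltNge ?ltn_eqF //; apply/negP => /(ts _ _ xy).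
by move/(st _ _ yx).
Qed.

Lemma leL_ind (P : 'S_n -> Prop) sigma :
  P sigma ->
  (forall gamma i, leL sigma gamma -> i \notin DesL gamma -> P gamma ->
     P (pcomp (sref i) gamma)) ->
  forall gamma, leL sigma gamma -> P gamma.
Proof.
move=> P0 Ps gamma /connectP [s].
elim/last_ind: s gamma => [|s tau IH] gamma /=; first by move=> _ ->.
rewrite rcons_path last_rcons => /andP [sp /existsP [i /andP [iD /eqP e]]] ->.
rewrite e; apply: Ps => //; last exact: IH.
by apply/connectP; exists s.
Qed.

Lemma DesL_s i gamma : (i \in DesL (pcomp (sref i) gamma)) = (i \notin DesL gamma).
Proof. by rewrite !DesLE; have := desc_s i gamma; rewrite /desc. Qed.

Lemma leL_down i gamma : i \in DesL gamma -> leL (pcomp (sref i) gamma) gamma.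
Proof.
by move=> iD; rewrite -{2}(pcomp_sK i gamma) leL_s // DesL_s negbK.
Qed.

Lemma len_s i gamma : i \notin DesL gamma -> len (pcomp (sref i) gamma) = (len gamma).+1.
Proof.
rewrite DesLE !lenE -leqNgt leq_eqVlt (negPf (pos_neq _ _)) /=.
exact: ninv_up.
Qed.

Lemma DesR_lt z p q : p < q -> z q < z p ->
  exists2 k, k \in DesR z & p <= k < q.
Proof.
move=> pq lt; apply: contrapT => no.
have : z p < z q.
  apply: (@step_lt (fun x => z x)) => // k pkq; rewrite perm_ltNge //=; last lia.
  by apply/negP => kD; apply: no; exists k; rewrite ?inE.
by lia.
Qed.

(** For [p < q]: both lie in one orbit of the subgroup generated by the [sref k] with [k] in [A]. *)
Definition joined A p q : bool := [forall k : 'I_n.-1, (p <= k < q) ==> (k \in A)].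

Lemma joinedP A p q : reflect (forall k, p <= k < q -> k \in A) (joined A p q).
Proof. by apply: (iffP forallP) => h k; have := h k; move/implyP. Qed.

(** Preserving this initial segment expresses, without words, that [sref k] does not occur in
    reduced words of [z]; [supp] below is therefore the usual support. *)
Definition stable k z : Prop := forall x, (z x <= k) = (x <= k).

Lemma stable_s i k : i != k -> stable k (sref i).
Proof. by rewrite -val_eqE /= => ik x; rewrite val_s; do 2?case: eqP => /=; lia. Qed.

Lemma stable1 k : stable k 1%g. Proof. by move=> x; rewrite perm1. Qed.

Lemma stableM k z u : stable k z -> stable k u -> stable k (z * u)%g.
Proof. by move=> sz sy x; rewrite permM sy sz. Qed.

Lemma stableV k z : stable k z -> stable k z^-1%g.
Proof. by move=> sz x; rewrite -{2}(permKV z x) sz. Qed.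

Lemma mem_w0 A : w0 A \in <<[set sref i | i in A]>>%g.
Proof. by rewrite /w0; case: arg_maxnP => //; exact: group1. Qed.

Lemma gen_stable A k z : z \in <<[set sref i | i in A]>>%g -> k \notin A -> stable k z.
Proof.
move=> zA kA.
have gS : group_set [set g : 'S_n | `[< stable k g >]].
  apply/group_setP; split; first by rewrite inE; apply/asboolP/stable1.
  by move=> x y; rewrite !inE => /asboolP sx /asboolP sy; apply/asboolP/stableM.
have sub : [set sref i | i in A] \subset Group gS.
  apply/subsetP => g /imsetP [i iA ->]; rewrite inE; apply/asboolP/stable_s.
  by apply: contraNneq kA => <-.
by move: zA; rewrite -gen_subG in sub; move/(subsetP sub); rewrite inE => /asboolP.
Qed.

Lemma DesL_w0 A i : i \in A -> i \in DesL (w0 A).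
Proof.
move=> iA; apply/negPn/negP => iD; have := mem_w0 A; have := len_s iD.
rewrite /w0; case: arg_maxnP => [|g gA gmax ls _]; first exact: group1.
have : pcomp (sref i) g \in <<[set sref i | i in A]>>%g.
  by rewrite /pcomp groupM // mem_gen //; apply: imset_f.
by move/gmax; rewrite /= ls ltnn.
Qed.

(** Maximal length makes every element of [A] a left descent, so values decrease along joined pairs;
    an index outside [A] cuts off a preserved initial segment, across which nothing is inverted. *)
Lemma w0_inv_lt A p q : p < q -> ((w0 A)^-1 q < (w0 A)^-1 p)%g = joined A p q.
Proof.
move=> pq; apply/idP/joinedP => [lt k pkq|h].
  apply/negPn/negP => /(gen_stable (mem_w0 A))/stableV sk.
  by have := sk p; have := sk q; lia.
apply: (@step_gt (fun x => ((w0 A)^-1)%g x)) => // k /h/DesL_w0.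
by rewrite DesLE.
Qed.

Lemma w0_lt A p q : p < q -> (w0 A q < w0 A p) = joined A p q.
Proof.
move=> pq; apply/idP/joinedP => [lt k pkq|h].
  apply/negPn/negP => /(gen_stable (mem_w0 A)) sk.
  by have := sk p; have := sk q; lia.
rewrite -[_ < _]negbK -perm_ltNge ?ltn_eqF //; apply/negP => lt.
have := w0_inv_lt A lt; rewrite !permK.
suff -> : joined A (w0 A p) (w0 A q) by lia.
apply/joinedP => k pkq; apply/negPn/negP => kA.
have sk := gen_stable (mem_w0 A) kA.
have /h : p <= k < q by have := sk p; have := sk q; lia.
by rewrite (negPf kA).
Qed.

Lemma w0V A : ((w0 A)^-1 = w0 A)%g.
Proof.
by apply: leL_anti; apply/leLP => p q pq; rewrite w0_lt ?w0_inv_lt.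
Qed.

Lemma w0K A : involutive (w0 A).
Proof. by move=> x; rewrite -{1}(w0V A) permK. Qed.

Definition wmax : 'S_n := w0 [set: 'I_n.-1].

Lemma wmax_lt p q : (wmax p < wmax q) = (q < p).
Proof.
have all x y : joined [set: 'I_n.-1] x y by apply/joinedP => k _; rewrite inE.
case: (ltngtP p q) => [pq|qp|/val_inj ->]; last by rewrite ltnn.
  by have := w0_lt setT pq; rewrite all /wmax => lt; rewrite ltnNge ltnW.
by have := w0_lt setT qp; rewrite all.
Qed.

Lemma w1E T p : w1 T p = wmax (w0 (~: T) p).
Proof. by rewrite pcompE. Qed.

Lemma w1_lt T p q : p < q -> (w1 T p < w1 T q) = joined (~: T) p q.
Proof. by move=> pq; rewrite !w1E wmax_lt w0_lt. Qed.

Lemma leL_w0 A z : leL (w0 A) z = (A \subset DesR z).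
Proof.
apply/leLP/subsetP => [h i iA|h p q pq].
  rewrite inE; apply: h; rewrite ?w0_lt //=; try lia.
  by apply/joinedP => k /= ?; have -> : k = i by apply: val_inj => /=; lia.
rewrite w0_lt // => /joinedP j; apply: (@step_gt (fun x => z x)) => // k /j /h.
by rewrite inE.
Qed.

Lemma leL_w1 T z : leL z (w1 T) = (DesR z \subset T).
Proof.
apply/leLP/subsetP => [h i|h p q pq zqp].
  rewrite inE => zi; have := h (ord_lo i) (ord_hi i) (ltnSn i) zi.
  rewrite (@perm_ltNge (w1 T)) /=; last lia.
  rewrite w1_lt /=; last lia; apply: contraNT => iT.
  apply/joinedP => k /= ?; have -> : k = i by apply: val_inj => /=; lia.
  by rewrite inE.
rewrite perm_ltNge ?gtn_eqF // w1_lt //; apply/negP => /joinedP j.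
have [k kz /j] := DesR_lt pq zqp.
by rewrite inE (h _ kz).
Qed.

Lemma in_intervalL sigma rho gamma :
  (gamma \in intervalL sigma rho) = leL sigma gamma && leL gamma rho.
Proof. by rewrite inE. Qed.

Definition supp z : {set 'I_n.-1} := [set k | ~~ `[< stable k z >]].

Lemma suppP k z : (k \notin supp z) <-> stable k z.
Proof. by rewrite inE negbK; split=> /asboolP. Qed.

Lemma suppPn k z : k \in supp z <-> ~ stable k z.
Proof. by rewrite inE; split=> [/negP h /asboolP //|h]; apply/negP => /asboolP. Qed.

End WeakOrder.

(** * Reduced words *)

Section ReducedWords.

Variables (n : nat) (R : pzRingType) (p : 'I_n.-1 -> R).
Implicit Types (i j k : 'I_n.-1) (z : 'S_n) (v w : seq 'I_n.-1).

Definition reduced w := size w == ninv (wprod w).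

Lemma ninv_s i z : i \in DesL z -> ninv z = (ninv (pcomp (sref i) z)).+1.
Proof. by rewrite DesLE => /ninv_down. Qed.

Lemma wprod_cat v w : wprod (v ++ w) = pcomp (wprod v) (wprod w).
Proof.
elim: v => [|i v /= ->]; first by rewrite /pcomp mulg1.
by rewrite pcompA.
Qed.

Lemma wprod_ninv w : ninv (wprod w) <= size w.
Proof.
elim: w => [|i w IH] /=; first by rewrite ninv1.
by apply: leq_trans (ninv_s_le _ _) _.
Qed.

Lemma reduced_cons i w : reduced (i :: w) -> reduced w /\ i \in DesL (wprod (i :: w)).
Proof.
rewrite /reduced /= => /eqP e; have := wprod_ninv w; have := ninv_s_le i (wprod w).
rewrite DesLE; have [lt|le] := ltnP ((wprod w)^-1 (ord_lo i))%g ((wprod w)^-1 (ord_hi i))%g.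
  rewrite !pcomp_s_inv s_lo s_hi lt; move: e; rewrite ninv_up //.
  by move=> [->]; rewrite eqxx.
have {}lt : i \in DesL (wprod w) by rewrite DesLE; have := pos_neq i (wprod w); lia.
by have := ninv_s lt; lia.
Qed.

Lemma ninvV z : ninv z^-1%g = ninv z.
Proof.
rewrite /ninv.
set A := [set _ | _]; set B := [set _ | _].
rewrite -(card_imset (mem A) (f := fun x => ((z^-1)%g x.2, (z^-1)%g x.1))); last first.
  by move=> [a b] [c d] [] /perm_inj -> /perm_inj ->.
apply: eq_card => -[a b]; rewrite !inE /=; apply/imsetP/andP => [[[c d]]|[ab ba]].
  by rewrite !inE /= => /andP [cd dc] [-> ->]; rewrite !permKV.
by exists (z b, z a); rewrite ?inE /= ?permK ?ba ?ab.
Qed.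

Lemma DesR_down j z : j \in DesR z -> ninv z = (ninv (pcomp z (sref j))).+1.
Proof.
rewrite -DesLV => /ninv_s; rewrite !ninvV => ->.
by rewrite -[in RHS]ninvV pcompV tpermV.
Qed.

Lemma redword_ex z : exists w, reduced w && (wprod w == z).
Proof. by have [w sw e] := wprod_ninv_ex z; exists w; rewrite /reduced e sw !eqxx. Qed.

Definition redword z := xchoose (redword_ex z).

Lemma redwordP z : reduced (redword z).
Proof. by have /andP [] := xchooseP (redword_ex z). Qed.

Lemma wprod_redword z : wprod (redword z) = z.
Proof. by have /andP [_ /eqP] := xchooseP (redword_ex z). Qed.

Lemma redword_s i z : i \notin DesL z -> reduced (i :: redword z).
Proof.
rewrite /reduced /= => iz; rewrite wprod_redword (@ninv_s i); last by rewrite DesL_s.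
by rewrite pcomp_sK eqSS -{2}(wprod_redword z) (eqP (redwordP z)).
Qed.

Local Open Scope ring_scope.

Hypothesis p_idem : forall i, p i * p i = p i.
Hypothesis p_braid : forall i j, j = i.+1 :> nat -> p i * p j * p i = p j * p i * p j.
Hypothesis p_comm : forall i j, (i.+1 < j)%N -> p i * p j = p j * p i.

Definition wordp w : R := \prod_(i <- w) p i.

Lemma wordp_cons i w : wordp (i :: w) = p i * wordp w.
Proof. exact: big_cons. Qed.

(* Matsumoto's theorem *)
Lemma wordp_reduced v w : reduced v -> reduced w -> wprod v = wprod w ->
  wordp v = wordp w.
Proof.
move: {2}(size v) (leqnn (size v)) => m.
elim: m v w => [|m IH] v w sv rv rw evw.
all: have sw : size v = size w by rewrite (eqP rv) (eqP rw) evw.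
all: case: v w sv sw rv rw evw => [|i v] [|j w] //= sv [sw] rv rw evw.
have [rv' iD] := reduced_cons rv; have [rw' jD] := reduced_cons rw.
rewrite /= in iD; rewrite -[X in j \in DesL X]evw /= in jD.
move E: (pcomp (sref i) (wprod v)) iD jD evw => z iD jD evw.
have ev : wprod v = pcomp (sref i) z by rewrite -E pcomp_sK.
have ew : wprod w = pcomp (sref j) z by rewrite evw pcomp_sK.
(* By induction a shorter word may be replaced by a reduced word of the same permutation beginning
   with any chosen left descent. *)
have reach k u y : reduced u -> (size u <= m)%N -> k \in DesL y ->
    wprod u = y -> wordp u = p k * wordp (redword (pcomp (sref k) y)).
  move=> ru su ky eu; rewrite -wordp_cons; apply: IH => //.
    by apply: redword_s; rewrite DesL_s ky.
  by rewrite eu /= wprod_redword pcomp_sK.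
rewrite !wordp_cons; have [eij|nij] := eqVneq i j.
  by rewrite eij; congr (_ * _); apply: IH => //; rewrite ev ew eij.
clear E evw.
wlog ij : i j v w sv sw rv rw rv' iD rw' jD ev ew nij / (i < j)%N => [hw|].
  case: (ltngtP i j) => [ij|ji|/val_inj ij].
  - exact: (hw i j v w).
  - by apply/esym; apply: (hw j i w v) => //; rewrite 1?eq_sym -?sw.
  - by rewrite ij eqxx in nij.
have v1 k y : pcomp (sref k) (pcomp (sref k) y) = y by exact: pcomp_sK.
have [gap|near] := ltnP i.+1 j.
  have jv : j \in DesL (wprod v).
    by rewrite ev; move: jD; rewrite !DesLE; have := desc_far2 gap z; rewrite /desc => ->.
  have iw : i \in DesL (wprod w).
    by rewrite ew; move: iD; rewrite !DesLE; have := desc_far1 gap z; rewrite /desc => ->.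
  rewrite (reach j v _ rv' sv jv erefl) (reach i w _ rw' _ iw erefl) -?sw //.
  by rewrite !mulrA (p_comm gap) ev ew (pcomp_s_comm gap).
have {}near : j = i.+1 :> nat by lia.
(* With both [i] and [j] as descents, [z] inverts all three pairs among three consecutive values.
   Both words can then be rewritten to start with the two sides of the braid relation. *)
have [+ _] := desc_near_lt near z; rewrite /desc -!DesLE => /(_ iD jD) zD.
have jv : j \in DesL (wprod v).
  by rewrite ev DesLE; have := desc_near_ji near z; rewrite /desc zD.
have iw : i \in DesL (wprod w).
  by rewrite ew DesLE; have := desc_near_ij near z; rewrite /desc zD.
rewrite (reach j v _ rv' sv jv erefl) (reach i w _ rw' _ iw erefl) -?sw //.
have iv : i \in DesL (pcomp (sref j) (wprod v)).
  rewrite ev DesLE; have := desc_near_ij near (pcomp (sref i) z).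
  by rewrite (desc_near_i near) /desc -!DesLE jD => ->.
have jw : j \in DesL (pcomp (sref i) (wprod w)).
  rewrite ew DesLE; have := desc_near_ji near (pcomp (sref j) z).
  by rewrite (desc_near_j near) /desc -!DesLE iD => ->.
have nv := ninv_s jv; have nw := ninv_s iw.
rewrite (reach i _ _ (redwordP _) _ iv (wprod_redword _)); last first.
  by rewrite (eqP (redwordP _)) wprod_redword -ltnS -nv -(eqP rv') leqW.
rewrite (reach j _ _ (redwordP _) _ jw (wprod_redword _)); last first.
  by rewrite (eqP (redwordP _)) wprod_redword -ltnS -nw -(eqP rw') -sw leqW.
by rewrite !mulrA (p_braid near) ev ew (pcomp_s_braid near).
Qed.

Definition perm_prod z : R := wordp (redword z).

Lemma perm_prod_wprod w : reduced w -> perm_prod (wprod w) = wordp w.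
Proof. by move=> rw; apply: wordp_reduced => //; [apply: redwordP|rewrite wprod_redword]. Qed.

Lemma perm_prod1 : perm_prod 1%g = 1.
Proof.
have := @perm_prod_wprod [::]; rewrite /wordp big_nil; apply.
by rewrite /reduced /= ninv1.
Qed.

Lemma perm_prod_s i z : i \notin DesL z -> perm_prod (pcomp (sref i) z) = p i * perm_prod z.
Proof.
move=> iz; rewrite -{1}(wprod_redword z) -wordp_cons -perm_prod_wprod //.
exact: redword_s.
Qed.

Lemma perm_prod_DesL i z : i \in DesL z -> p i * perm_prod z = perm_prod z.
Proof.
move=> iz; rewrite -(pcomp_sK i z) perm_prod_s; last by rewrite DesL_s iz.
by rewrite mulrA p_idem.
Qed.

Lemma perm_prod_DesR j z : j \in DesR z -> exists c, perm_prod z = c * p j.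
Proof.
move=> jz; exists (wordp (redword (pcomp z (sref j)))).
have e : wprod (rcons (redword (pcomp z (sref j))) j) = z.
  by rewrite -cats1 wprod_cat wprod_redword /= /pcomp mul1g mulgA tperm2 mul1g.
rewrite -{1}e perm_prod_wprod /wordp ?big_rcons //=.
by rewrite /reduced e size_rcons (DesR_down jz) (eqP (redwordP _)) wprod_redword.
Qed.

End ReducedWords.

(** * Supports of permutations *)

Section Support.

Variable n : nat.
Implicit Types (i j k : 'I_n.-1) (z gamma : 'S_n) (A T : {set 'I_n.-1}).

Lemma leL1 z : leL 1%g z.
Proof. by apply/leLP => p q pq; rewrite !perm1; lia. Qed.

Lemma perm_s_ind (P : 'S_n -> Prop) : P 1%g ->
  (forall z i, i \notin DesL z -> P z -> P (pcomp (sref i) z)) -> forall z, P z.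
Proof. by move=> P1 Ps z; apply: (leL_ind P1) (leL1 z) => g i _; apply: Ps. Qed.

Lemma supp1 : supp (1 : 'S_n)%g = set0.
Proof. by apply/setP => k; rewrite in_set0; apply/negbTE/suppP/stable1. Qed.

Lemma DesL_supp z : DesL z \subset supp z.
Proof.
apply/subsetP => i; rewrite DesLE => lt; apply/suppPn => /stableV sz.
by have := sz (ord_lo i); have := sz (ord_hi i) => /=; lia.
Qed.

Lemma supp_s i z : i \notin DesL z -> supp (pcomp (sref i) z) = i |: supp z.
Proof.
move=> iz; apply/setP => k; rewrite in_setU1; have [->|ki] := eqVneq k i.
  by apply: (subsetP (DesL_supp _)); rewrite DesL_s.
rewrite !inE; congr (~~ _); apply/asboolP/asboolP => sz; last first.
  by apply: stableM => //; apply: stable_s; rewrite eq_sym.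
rewrite -(pcomp_sK i z); apply: stableM => //; apply: stable_s; by rewrite eq_sym.
Qed.

Lemma supp_w0 A : supp (w0 A) = A.
Proof.
apply/setP => k; apply/idP/idP => [|kA].
  by apply: contraLR => kA; apply/suppP/(gen_stable (mem_w0 A)).
by apply: (subsetP (DesL_supp _)); apply: DesL_w0.
Qed.

Lemma leL_supp z gamma : leL z gamma -> supp z \subset supp gamma.
Proof.
apply: (leL_ind (P := fun g => supp z \subset supp g)) => // g i _ ig sg.
by rewrite supp_s //; apply: subset_trans sg (subsetUr _ _).
Qed.

Lemma DesR_w0 A : DesR (w0 A) = A.
Proof.
apply/eqP; rewrite eqEsubset -leL_w0 leL_refl andbT; apply/subsetP => i.
by rewrite inE w0_lt ?ltnSn // => /joinedP; apply; rewrite /= leqnn ltnSn.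
Qed.

Lemma leL_w0_w1 A T : leL (w0 A) (w1 T) = (A \subset T).
Proof. by rewrite leL_w1 DesR_w0. Qed.

End Support.

Local Open Scope ring_scope.

(** * The 0-Hecke algebra and its products along reduced words *)

Section H0Modules.

Variables (K : fieldType) (n : nat).
Local Notation H := (H0 K n).
Local Notation gen := (H0gen K).
Implicit Types (i j k : 'I_n.-1) (z : 'S_n) (A T : {set 'I_n.-1}).

Lemma H0_ind (P : H -> Prop) : (forall a : K, P a%:A) -> (forall i, P (gen i)) ->
  (forall x y, P x -> P y -> P (x + y)) -> (forall x y, P x -> P y -> P (x * y)) ->
  forall x, P x.
Proof.
move=> Pa Pg PD PM; elim/hpi_ind; elim=> [i|a|t IHt u IHu|t IHt u IHu].
- exact: Pg.
- by have := Pa a; rewrite -[a%:A]/(hscal n a * 1) mulr1.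
- by have := PD _ _ IHt IHu; rewrite [_ + _]haddE.
- by have := PM _ _ IHt IHu; rewrite [_ * _]hmulE.
Qed.

Lemma linear_gen (X Y : lmodType H) (F : X -> Y) :
  (forall u v, F (u + v) = F u + F v) ->
  (forall (a : K) v, F (a%:A *: v) = a%:A *: F v) ->
  (forall i v, F (gen i *: v) = gen i *: F v) -> linear F.
Proof.
move=> FD Fa Fg h u v; rewrite FD; congr (_ + _); elim/H0_ind: h u => //.
- by move=> x y IHx IHy u; rewrite !scalerDl FD IHx IHy.
- by move=> x y IHx IHy u; rewrite -!scalerA IHx IHy.
Qed.

Lemma genC_idem i : (1 - gen i) * (1 - gen i) = 1 - gen i.
Proof. by rewrite mulrBr mulr1 mulrBl mul1r H0gen_idem subrr subr0. Qed.

Lemma genC_comm i j : (i.+1 < j)%N -> (1 - gen i) * (1 - gen j) = (1 - gen j) * (1 - gen i).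
Proof.
move=> ij; have c : GRing.comm (gen i) (gen j) by apply: H0gen_comm; rewrite ij.
apply: commrB; first exact: commr1.
by apply/commr_sym; apply: commrB; [exact: commr1|exact/commr_sym].
Qed.

Lemma genC_braid i j : j = i.+1 :> nat ->
  (1 - gen i) * (1 - gen j) * (1 - gen i) = (1 - gen j) * (1 - gen i) * (1 - gen j).
Proof.
move=> ij; have br := H0gen_braid K ij.
(* The expansion is symmetric in [a] and [b] except for the term [a * b * a], which the braid
   relation makes symmetric. *)
have expand (a b : H) : a * a = a ->
    (1 - a) * (1 - b) * (1 - a) = 1 - a + (b * a - a * b * a) + (a * b - b).
  move=> aa; rewrite [(1 - a) * (1 - b)]mulrBr mulr1 mulrBl.
  have -> : (1 - a) * (1 - a) = 1 - a by rewrite mulrBr mulr1 mulrBl mul1r aa subrr subr0.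
  by rewrite mulrBr mulr1 !mulrBl !mul1r !opprB !addrA.
rewrite !expand ?H0gen_idem // br; set c := _ * gen j.
by rewrite !addrA [LHS](AC (1*1*1*1*1*1) (1*6*5*4*3*2)).
Qed.

Definition pi z : H := perm_prod (@H0gen K n) z.
Definition pibar z : H := perm_prod (fun i => 1 - gen i) z.

Let gen_comm i j : (i.+1 < j)%N -> gen i * gen j = gen j * gen i.
Proof. by move=> ij; apply: H0gen_comm; rewrite ij. Qed.

Lemma pi_s i z : i \notin DesL z -> pi (pcomp (sref i) z) = gen i * pi z.
Proof. exact: (perm_prod_s (@H0gen_braid K n) gen_comm). Qed.

Lemma pi_DesL i z : i \in DesL z -> gen i * pi z = pi z.
Proof. exact: (perm_prod_DesL (@H0gen_idem K n) (@H0gen_braid K n) gen_comm). Qed.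

Lemma pi_DesR j z : j \in DesR z -> exists c, pi z = c * gen j.
Proof. exact: (perm_prod_DesR (@H0gen_braid K n) gen_comm). Qed.

Lemma pibar_s i z :
  i \notin DesL z -> pibar (pcomp (sref i) z) = (1 - gen i) * pibar z.
Proof. exact: (perm_prod_s genC_braid genC_comm). Qed.

Lemma gen_pibar i z : i \in DesL z -> gen i * pibar z = 0.
Proof.
move=> iz; have e := perm_prod_DesL genC_idem genC_braid genC_comm iz.
by apply/oppr_inj/(addrI (pibar z)); rewrite oppr0 addr0 -[RHS]e mulrBl mul1r.
Qed.

Lemma pi1 : pi 1%g = 1.
Proof. exact: (perm_prod1 (@H0gen_braid K n) gen_comm). Qed.

Lemma pibar1 : pibar 1%g = 1.
Proof. exact: (perm_prod1 genC_braid genC_comm). Qed.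

Lemma pi_fix (X : lmodType H) (x : X) z :
  (forall i, i \in supp z -> gen i *: x = x) -> pi z *: x = x.
Proof.
elim/perm_s_ind: z => [|z i iz IH] fx; first by rewrite pi1 scale1r.
rewrite pi_s // -scalerA IH ?fx // => [|j jz]; first by rewrite supp_s // setU11.
by apply: fx; rewrite supp_s // setU1r.
Qed.

End H0Modules.

(** * Interval modules *)

Section IntervalModules.

Variables (K : fieldType) (n : nat) (sigma rho : 'S_n).
Local Notation H := (H0 K n).
Local Notation gen := (H0gen K).
Local Notation I := (intervalL sigma rho).
Local Notation M := (Bmod K sigma rho).
Implicit Types (i j k : 'I_n.-1) (g z : 'S_n) (x y : {gamma | gamma \in I}) (u v : M).

(** Defined for every permutation and zero outside the interval ([bvec_out]), so that a step leaving
    the interval needs no separate case in [gen_bvec]. *)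
Definition bvec g : M := Bvec K I g.

Definition bcoef v x : K := (v : {ffun {gamma | gamma \in I} -> K^o}) x.

Lemma bcoefD u v x : bcoef (u + v) x = bcoef u x + bcoef v x.
Proof. exact: ffunE. Qed.

Lemma bcoefZ (a : K) v x : bcoef (a%:A *: v) x = a * bcoef v x.
Proof. by rewrite /bcoef hmod_scalE ffunE. Qed.

Lemma bcoef0 x : bcoef 0 x = 0.
Proof. exact: ffunE. Qed.

Lemma bcoef_sum (J : Type) (r : seq J) (P : pred J) (F : J -> M) x :
  bcoef (\sum_(j <- r | P j) F j) x = \sum_(j <- r | P j) bcoef (F j) x.
Proof.
by elim/big_rec2: _ => [|j a b _ <-]; rewrite ?bcoef0 ?bcoefD.
Qed.

Lemma bcoefP u v : (forall x, bcoef u x = bcoef v x) -> u = v.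
Proof. by move=> e; apply/ffunP. Qed.

Lemma bcoef_vec g x : bcoef (bvec g) x = (val x == g)%:R.
Proof. exact: ffunE. Qed.

Lemma bvec_out g : g \notin I -> bvec g = 0.
Proof.
move=> gI; apply: bcoefP => x; rewrite bcoef_vec bcoef0.
by case: eqP gI => // <-; rewrite (valP x).
Qed.

Lemma bmod_basis v : v = \sum_x (bcoef v x)%:A *: bvec (val x).
Proof.
apply: bcoefP => x; rewrite bcoef_sum (bigD1 x) //= big1 ?addr0.
  by rewrite bcoefZ bcoef_vec eqxx mulr1.
by move=> y yx; rewrite bcoefZ bcoef_vec val_eqE eq_sym (negPf yx) mulr0.
Qed.

Lemma gen_bvec i g : g \in I ->
  gen i *: bvec g = if i \in DesL g then bvec g else bvec (pcomp (sref i) g).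
Proof.
move=> gI; rewrite hmod_genE [LHS]Bpi_vec // /step.
by case: ifP => //= _; case: ifP => //= sI; rewrite bvec_out ?sI.
Qed.

Definition bext (X : lmodType H) (F : 'S_n -> X) (v : M) : X :=
  \sum_x (bcoef v x)%:A *: F (val x).

Section Extension.

Variables (X : lmodType H) (F : 'S_n -> X).
Hypothesis F_gen : forall i g, g \in I -> gen i *: F g =
  if i \in DesL g then F g else if pcomp (sref i) g \in I then F (pcomp (sref i) g) else 0.

Lemma bextD u v : bext F (u + v) = bext F u + bext F v.
Proof.
rewrite -big_split; apply: eq_bigr => x _ /=.
by rewrite bcoefD !scalerDl.
Qed.

Lemma bextZ (a : K) v : bext F (a%:A *: v) = a%:A *: bext F v.
Proof.
rewrite scaler_sumr; apply: eq_bigr => x _.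
by rewrite bcoefZ scalerA -scalerAl mul1r scalerA.
Qed.

Lemma bext0 : bext F 0 = 0.
Proof. by apply: (addrI (bext F 0)); rewrite -bextD !addr0. Qed.

Lemma bext_vec g : g \in I -> bext F (bvec g) = F g.
Proof.
move=> gI; rewrite /bext (bigD1 (Sub g gI)) //= big1 ?addr0.
  by rewrite bcoef_vec eqxx !scale1r.
by move=> x xg; rewrite bcoef_vec -[g]/(val (Sub g gI : {g | g \in I})) val_eqE (negPf xg) !scale0r.
Qed.

(** [F_gen] copies the action of the generators on the basis, so the extension commutes with
    generators and scalars, which suffices by [linear_gen]. *)
Lemma bext_linear : linear (bext F).
Proof.
apply: linear_gen; [exact: bextD|exact: bextZ|] => i v.
have bext_sum (G : {gamma | gamma \in I} -> M) : bext F (\sum_x G x) = \sum_x bext F (G x).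
  by elim/big_rec2: _ => [|x a b _ <-]; rewrite ?bext0 ?bextD.
have comm (Y : lmodType H) (a : K) (w : Y) : gen i *: (a%:A *: w) = a%:A *: (gen i *: w).
  by rewrite !scalerA mulr_algr mulr_algl.
rewrite {1}[v]bmod_basis [in RHS]/bext !scaler_sumr bext_sum; apply: eq_bigr => x _.
rewrite !comm bextZ F_gen ?(valP x) // gen_bvec ?(valP x) //; congr (_ *: _).
case: ifP => _; first by rewrite bext_vec ?(valP x).
by case: ifP => sI; [rewrite bext_vec|rewrite bvec_out ?sI // bext0].
Qed.

Definition bext_lin : {linear M -> X} :=
  HB.pack (bext F) (GRing.isLinear.Build H M X *:%R (bext F) bext_linear).

End Extension.

(** Climbing from [sigma] to [z] applies generators at ascents only. A path that leaves the interval
    never returns, in agreement with [bvec] being zero outside. *)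
Lemma pi_bvec_gen z : pi K sigma *: bvec sigma = bvec sigma -> leL sigma z ->
  pi K z *: bvec sigma = bvec z.
Proof.
move=> fix_s; elim/leL_ind: z / => //= [z i sz iz IH].
rewrite pi_s // -scalerA IH.
have [zI|zI] := boolP (z \in I); first by rewrite gen_bvec // (negPf iz).
rewrite (bvec_out zI) scaler0 bvec_out //.
apply: contra zI; rewrite !in_intervalL sz => /andP [_]; exact: leL_trans (leL_s iz).
Qed.

End IntervalModules.

(** * The projective interval modules *)

Section SpannedBy.

Variables (K : fieldType) (n : nat) (sigma rho : 'S_n).
Local Notation H := (H0 K n).
Local Notation gen := (H0gen K).
Local Notation I := (intervalL sigma rho).
Local Notation M := (Bmod K sigma rho).
Implicit Types (i j k : 'I_n.-1) (g z : 'S_n) (x y : {gamma | gamma \in I}) (u v : M).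
Implicit Types (Q : pred 'S_n) (h : H).

Local Notation vec := (bvec K sigma rho).

Definition spanned Q v := forall x, bcoef v x != 0 -> Q (val x).

Lemma spanned0 Q : spanned Q 0.
Proof. by move=> x; rewrite bcoef0 eqxx. Qed.

Lemma spannedD Q u v : spanned Q u -> spanned Q v -> spanned Q (u + v).
Proof.
move=> su sv x; rewrite bcoefD; apply: contra_neqT => nQ.
have /eqP -> : bcoef u x == 0 by apply: contraNT nQ => /su.
have /eqP -> : bcoef v x == 0 by apply: contraNT nQ => /sv.
by rewrite addr0.
Qed.

Lemma spannedZ Q (a : K) v : spanned Q v -> spanned Q (a%:A *: v).
Proof.
move=> sv x; rewrite bcoefZ; apply: contra_neqT => nQ.
by have /eqP -> : bcoef v x == 0 by [apply: contraNT nQ => /sv]; rewrite mulr0.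
Qed.

Lemma spannedB Q u v : spanned Q u -> spanned Q v -> spanned Q (u - v).
Proof.
move=> su sv; apply: spannedD => //.
by rewrite -scaleN1r -[-1]mulr1 mulN1r -(scale1r (1 : H)) -scaleNr; apply: spannedZ.
Qed.

Lemma spanned_vec Q g : Q g -> spanned Q (vec g).
Proof. by move=> Qg x; rewrite bcoef_vec; case: (eqVneq (val x) g) => [->|] //; rewrite eqxx. Qed.

Lemma spanned_sum Q (L : finType) (F : L -> M) :
  (forall l, spanned Q (F l)) -> spanned Q (\sum_l F l).
Proof. by move=> sF; elim/big_ind: _ => //; [exact: spanned0|exact: spannedD]. Qed.

Lemma spanned_act Q h v :
  (forall x, bcoef v x != 0 -> spanned Q (h *: vec (val x))) -> spanned Q (h *: v).
Proof.
move=> sv; rewrite [v]bmod_basis scaler_sumr; apply: spanned_sum => x.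
have [->|nx] := eqVneq (bcoef v x) 0; first by rewrite !scale0r scaler0; apply: spanned0.
by rewrite scalerA mulr_algr -mulr_algl -scalerA; apply/spannedZ/sv.
Qed.

Lemma spanned_stable Q h v :
  (forall i g, i \notin DesL g -> Q g -> Q (pcomp (sref i) g)) -> spanned Q v -> spanned Q (h *: v).
Proof.
move=> Qs; elim/H0_ind: h v => [a|i|h1 h2 IH1 IH2|h1 h2 IH1 IH2] v sv.
- exact: spannedZ.
- apply: spanned_act => x /sv Qx; rewrite gen_bvec ?(valP x) //.
  by case: ifPn => iD; apply: spanned_vec => //; apply: Qs.
- by rewrite scalerDl; apply: spannedD; [apply: IH1|apply: IH2].
- by rewrite -scalerA; apply/IH1/IH2.
Qed.

Definition fil m : pred 'S_n := fun z => (m <= len z)%N.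

Lemma fil_stable m h v : spanned (fil m) v -> spanned (fil m) (h *: v).
Proof. by apply: spanned_stable => i g iD; rewrite /fil len_s //; lia. Qed.

Lemma spanned_fil m v : (n * n < m)%N -> spanned (fil m) v -> v = 0.
Proof.
move=> nm sv; apply: bcoefP => x; rewrite bcoef0; apply/eqP; apply: contraTT nm => /sv.
rewrite /fil lenE -leqNgt => le; apply: leq_trans le _.
by rewrite /ninv; apply: leq_trans (max_card _) _; rewrite card_prod card_ord.
Qed.

(* Such h form an ideal that is nilpotent on M, since lengths are bounded.    *)
Definition raises h := forall m v, spanned (fil m) v -> spanned (fil m.+1) (h *: v).

Lemma raisesD h1 h2 : raises h1 -> raises h2 -> raises (h1 + h2).
Proof. by move=> r1 r2 m v sv; rewrite scalerDl; apply: spannedD; [apply: r1|apply: r2]. Qed.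

Lemma raises0 : raises 0.
Proof. by move=> m v _; rewrite scale0r; apply: spanned0. Qed.

Lemma raisesZ (a : K) h : raises h -> raises (a%:A * h).
Proof. by move=> r m v sv; rewrite -scalerA; apply/spannedZ/r. Qed.

Lemma raises_vec h : (forall g, g \in I -> spanned (fil (len g).+1) (h *: vec g)) -> raises h.
Proof.
move=> hv m v sv; apply: spanned_act => x /sv mx y /(hv _ (valP x)).
by apply: leq_trans; rewrite ltnS.
Qed.

Lemma raises_nilp h v : raises h -> h ^+ (n * n).+1 *: v = 0.
Proof.
move=> rh; suff : forall m, spanned (fil m) (h ^+ m *: v) by move/(_ _)/(spanned_fil (ltnSn _)).
elim=> [|m IH]; first by move=> x _.
by rewrite exprS -scalerA; apply: rh.
Qed.

(** If all letters of [z] are descents of [g], each of them fixes [g]. Otherwise the first letter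
    applied that is not a descent lengthens [g] or kills it, and later letters never shorten. *)
Lemma pi_bvec g z : g \in I ->
  if supp z \subset DesL g then pi K z *: vec g = vec g
  else spanned (fil (len g).+1) (pi K z *: vec g).
Proof.
move=> gI; elim/perm_s_ind: z => [|z i iz]; first by rewrite supp1 sub0set pi1 scale1r.
rewrite supp_s // subUset sub1set pi_s // -scalerA.
case: ifP => /= [sz ->|sz sp]; last by rewrite andbF; apply: fil_stable.
rewrite andbT gen_bvec //; case: (boolP (i \in DesL g)) => // iD.
by apply: spanned_vec; rewrite /fil len_s.
Qed.

(* On the quotient by longer elements both act on g as 1 if supp z is         *)
(* contained in DesL g, and as 0 otherwise.                                   *)
Lemma raises_pi_supp z : raises (pi K z - pi K (w0 (supp z))).
Proof.
apply: raises_vec => g gI; have := pi_bvec z gI; have := pi_bvec (w0 (supp z)) gI.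
rewrite supp_w0 scalerBl; case: ifP => _ => [-> ->|]; last first.
  by move=> s1 s2; apply: spannedB.
by rewrite subrr; apply: spanned0.
Qed.

End SpannedBy.

Section ProjectiveInterval.

Variables (K : fieldType) (n : nat) (A T : {set 'I_n.-1}).
Hypothesis AT : A \subset T.
Local Notation H := (H0 K n).
Local Notation gen := (H0gen K).
Local Notation I := (intervalL (w0 A) (w1 T)).
Local Notation E := (Bmod K (w0 A) (w1 T)).
Implicit Types (i j k : 'I_n.-1) (g z : 'S_n) (x y : {gamma | gamma \in I}) (u v : E) (h : H).

Local Notation vec := (bvec K (w0 A) (w1 T)).
Local Notation e := (vec (w0 A)).

Lemma w0_in : w0 A \in I.
Proof. by rewrite in_intervalL leL_refl leL_w0_w1. Qed.

Lemma pi_w0_top : pi K (w0 A) *: e = e.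
Proof.
apply: pi_fix => i; rewrite supp_w0 => iA; rewrite gen_bvec ?w0_in //.
by rewrite DesL_w0.
Qed.

Lemma pi_top z : leL (w0 A) z -> pi K z *: e = vec z.
Proof. exact/pi_bvec_gen/pi_w0_top. Qed.

Lemma top_cyclic v : exists h, v = h *: e.
Proof.
exists (\sum_x (bcoef v x)%:A * pi K (val x)).
rewrite {1}[v]bmod_basis scaler_suml; apply: eq_bigr => x _; rewrite -[RHS]scalerA pi_top //.
by have := valP x; rewrite in_intervalL => /andP [].
Qed.

Definition offT : pred 'S_n := fun z => ~~ (supp z \subset T).

Lemma offT_stable h v : spanned offT v -> spanned offT (h *: v).
Proof.
apply: spanned_stable => i g iD; rewrite /offT supp_s //; apply: contra.
by apply: subset_trans; apply: subsetUr.
Qed.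

(** When the support of $z$ is not inside $T$, $w_0(\mathrm{supp}\,z)$ is outside the interval, so
    its product kills $e$. Hence $z=(\pi_z-\pi_{w_0(\mathrm{supp}\,z)})e$, and this difference
    raises lengths by [raises_pi_supp]. *)
Lemma offT_raises v : spanned offT v -> exists2 h, raises (w0 A) (w1 T) h & v = h *: e.
Proof.
move=> sv.
exists (\sum_x (bcoef v x)%:A * (pi K (val x) - pi K (w0 (supp (val x))))).
  elim/big_ind: _ => [||x _]; [exact: raises0|exact: raisesD|].
  exact/raisesZ/raises_pi_supp.
rewrite {1}[v]bmod_basis scaler_suml; apply: eq_bigr => x _; rewrite -[RHS]scalerA.
have [->|nx] := eqVneq (bcoef v x) 0; first by rewrite !scale0r.
have /andP [Ax _] : leL (w0 A) (val x) && leL (val x) (w1 T) by rewrite -in_intervalL (valP x).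
congr (_ *: _); rewrite scalerBl !pi_top //; last first.
  by rewrite leL_w0 DesR_w0; have := leL_supp Ax; rewrite supp_w0.
rewrite [X in _ - X]bvec_out ?subr0 // in_intervalL leL_w0_w1 negb_and.
by have := sv _ nx; rewrite /offT => ->; rewrite orbT.
Qed.

Lemma geomR (R : pzRingType) (q : R) N : q * (\sum_(i < N) (1 - q) ^+ i) = 1 - (1 - q) ^+ N.
Proof.
have := subrX1 (1 - q) N; rewrite [1 - q - 1]addrAC subrr add0r mulNr => /eqP.
by rewrite -eqr_oppLR opprB => /eqP.
Qed.

Lemma geomL (R : pzRingType) (q : R) N : (\sum_(i < N) (1 - q) ^+ i) * q = 1 - (1 - q) ^+ N.
Proof.
rewrite -geomR mulr_suml mulr_sumr; apply: eq_bigr => i _; apply/commr_sym/commrX.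
by apply: commrB; [exact: commr1|exact: commr_refl].
Qed.

(** With $v=he$ and $h$ nilpotent on the module, $1-h$ is inverted by a finite geometric series. *)
Lemma offT_superfluous v : spanned offT v -> exists h, h *: (e - v) = e.
Proof.
case/offT_raises => h rh ->; exists (\sum_(i < (n * n).+1) h ^+ i).
have -> : e - h *: e = (1 - h) *: e by rewrite scalerBl scale1r.
rewrite scalerA.
have := geomL (1 - h) (n * n).+1; rewrite subKr => ->.
by rewrite scalerBl scale1r raises_nilp // subr0.
Qed.

(** This makes $g\mapsto\pi_g x$ extend to a morphism ([bext_lin]). Going up out of the interval
    creates a right descent $j\notin T$; the product then ends in $\pi_j$, which kills [x]. *)
Lemma pi_Hom_gen (X : lmodType H) (x : X) :
  (forall j, j \notin T -> gen j *: x = 0) ->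
  forall i g, g \in I -> gen i *: (pi K g *: x) =
    if i \in DesL g then pi K g *: x
    else if pcomp (sref i) g \in I then pi K (pcomp (sref i) g) *: x else 0.
Proof.
move=> x0 i g gI; rewrite scalerA; case: ifPn => iD; first by rewrite pi_DesL.
rewrite -pi_s //; case: ifPn => // sI.
have : ~~ (DesR (pcomp (sref i) g) \subset T).
  apply: contra sI; rewrite -leL_w1 in_intervalL => ->; rewrite andbT.
  by move: gI; rewrite in_intervalL => /andP [Ag _]; apply: leL_trans Ag (leL_s iD).
case/subsetPn => j /(pi_DesR K) [c ->] /x0 jx.
by rewrite -scalerA jx scaler0.
Qed.

(** For $i\notin T$, $\pi_i$ sends every basis vector to zero or to one whose support contains $i$,
    so $1-\pi_i$ is the identity modulo that span. *)
Lemma pibar_off z v : supp z \subset ~: T -> spanned offT (pibar K z *: v - v).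
Proof.
elim/perm_s_ind: z => [_|z i iz IH]; first by rewrite pibar1 scale1r subrr; apply: spanned0.
rewrite supp_s // subUset sub1set inE => /andP [iT /IH sz].
rewrite pibar_s // -scalerA scalerBl scale1r addrAC; apply: spannedB => //.
apply: spanned_act => x _; rewrite gen_bvec ?(valP x) //.
case: ifPn => iD; apply: spanned_vec; apply: contra iT => /subsetP; apply.
  exact: subsetP (DesL_supp _) _ iD.
by rewrite supp_s // setU11.
Qed.

(** Every [b *: x] is killed by the $\pi_j$ with $j\notin T$, so [pi_Hom_gen] applies to it; the
    resulting morphism sends [e] to [q *: x]. *)
Let b : H := pibar K (w0 (~: T)).
Let q : H := pi K (w0 A) * b.

Lemma gen_b (X : lmodType H) (x : X) j : j \notin T -> gen j *: (b *: x) = 0.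
Proof. by move=> jT; rewrite scalerA gen_pibar ?scale0r // DesL_w0 // inE. Qed.

(** Right multiplication by [q] is the endomorphism of [E] that sends [e] to [q *: e]. *)
Lemma mulq_wd h h' : h *: e = h' *: e -> h * q *: e = h' * q *: e.
Proof.
pose phi := bext_lin (pi_Hom_gen (fun j => @gen_b _ e j)).
have phie : phi e = q *: e by rewrite [phi e]bext_vec ?w0_in // scalerA.
have phiZ (l : H) : phi (l *: e) = l * q *: e by rewrite -scalerA -phie; exact: linearZ.
by move=> eh; rewrite -!phiZ eh.
Qed.

(* q * e = (1 - h) * e for a nilpotent h, and right multiplication by q is    *)
(* well defined on E, so that (1 - q) ^+ N kills e.                           *)
Lemma q_top : exists c, q * c *: e = e.
Proof.
have off_q : spanned offT (e - q *: e).
  rewrite -[X in spanned _ X]opprK opprB -scalerA -{2}pi_w0_top -scalerBr.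
  rewrite -[X in spanned _ X]scaleN1r.
  by apply: offT_stable; apply: offT_stable; apply: pibar_off; rewrite supp_w0.
have [h rh eh] := offT_raises off_q.
exists (\sum_(i < (n * n).+1) (1 - q) ^+ i); rewrite geomR scalerBl scale1r.
suff -> : (1 - q) ^+ (n * n).+1 *: e = 0 by rewrite subr0.
rewrite -(raises_nilp e rh); elim: (n * n).+1 => // m IH.
rewrite !exprSr -[RHS]scalerA -eh scalerBr scalerA -(mulq_wd IH) -IH.
by rewrite mulrBr mulr1 scalerBl.
Qed.

Lemma top_projective (X Y : lmodType H) (f : {linear X -> Y}) (g : {linear E -> Y}) :
  surjective f -> exists h : {linear E -> X}, forall v, f (h v) = g v.
Proof.
move=> sf; have [c qc] := q_top; have [x0 fx0] := sf (g e).
(* Here [e] is lifted to $qc\,x_0$, whose image is $qc\,g(e)=g(qc\,e)=g(e)$. *)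
pose h := bext_lin (pi_Hom_gen (fun j => @gen_b X (c *: x0) j)).
exists h => v; have [k ->] := top_cyclic v.
suff fhe : f (h e) = g e by rewrite !linearZ /= fhe.
by rewrite [h e]bext_vec ?w0_in // !linearZ /= fx0 !scalerA -linearZ qc.
Qed.

Lemma top_fin_gen : fin_gen E.
Proof.
exists 1%N, (fun=> e) => v; have [h ->] := top_cyclic v.
by exists (fun=> h); rewrite big_ord1.
Qed.

Lemma top_essential (N X : lmodType H) (f : {linear E -> N}) (g : {linear X -> E}) :
  (forall v, f v = 0 -> spanned offT v) -> surjective (f \o g) -> surjective g.
Proof.
move=> kf sfg; have [x fgx] := sfg (f e).
have [h eh] : exists h, h *: (e - (e - g x)) = e.
  by apply/offT_superfluous/kf; rewrite linearB -[f (g x)]/((f \o g) x) fgx subrr.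
move=> v; have [k ->] := top_cyclic v; exists (k * h *: x).
by rewrite linearZ -[in RHS]eh subKr scalerA.
Qed.

End ProjectiveInterval.

(** * Projective covers *)

(* A projective cover whose lifting and superfluity properties are tested on  *)
(* all modules, so that they also apply to duals of modules.                  *)
Definition strong_cover (R : pzRingType) (N P : lmodType R) : Prop :=
  [/\ fin_gen P,
      forall (X Y : lmodType R) (f : {linear X -> Y}) (g : {linear P -> Y}),
        surjective f -> exists h : {linear P -> X}, forall v, f (h v) = g v
    & exists2 f : {linear P -> N}, surjective f &
        forall (X : lmodType R) (g : {linear X -> P}), surjective (f \o g) -> surjective g].

Lemma supp_leL n (z : 'S_n) (B : {set 'I_n.-1}) : supp z \subset B -> leL z (w0 B).
Proof.
move=> /subsetP zB; apply/leLP => p q pq zqp; rewrite w0_lt //.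
apply/joinedP => k pkq; apply: zB; apply/suppPn => sk.
by have := sk p; have := sk q; lia.
Qed.

(* Right translation by u of an interval on which it preserves left descents  *)
(* is an isomorphism onto the interval between the translated end points.     *)
Section Translation.

Variables (n : nat) (sigma rho u : 'S_n).
Implicit Types (i : 'I_n.-1) (gamma : 'S_n).
Local Notation I := (intervalL sigma rho).

Hypothesis Desu : forall gamma, gamma \in I -> DesL (pcomp gamma u) = DesL gamma.

Lemma leL_translate gamma delta : leL sigma gamma -> leL gamma delta -> leL delta rho ->
  leL (pcomp gamma u) (pcomp delta u).
Proof.
move=> sg gd; elim/leL_ind: delta / gd => [_|delta i gd iD IH dr]; first exact: leL_refl.
have {}dr := leL_trans (leL_s iD) dr.
apply: leL_trans (IH dr) _; rewrite -pcompA; apply: leL_s.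
by rewrite Desu // in_intervalL dr (leL_trans sg gd).
Qed.

(** The only new inverted pair is formed by the positions of the values $i,i+1$. As $i$ is also an
    ascent of $\gamma u$, these positions keep their order after translation, so the pair is
    inverted in $\rho u$ and therefore in $\rho$. *)
Lemma translate_up i gamma : gamma \in I -> i \notin DesL gamma ->
  leL (pcomp (sref i) (pcomp gamma u)) (pcomp rho u) -> leL (pcomp (sref i) gamma) rho.
Proof.
move=> gI iD /leLP inv; apply/leLP => p q pq.
have [_ /leLP gr] : leL sigma gamma /\ leL gamma rho by apply/andP; rewrite -in_intervalL.
rewrite inv_s // => /orP [/(gr _ _ pq) //|/andP [/eqP gp /eqP gq]].
have iDu : i \notin DesL (pcomp gamma u) by rewrite Desu.
have lt : ((u^-1)%g p < (u^-1)%g q)%N.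
  have := iDu; rewrite DesLE -leqNgt leq_eqVlt (negPf (pos_neq _ _)) /= pcompV !pcompE.
  by rewrite -gp -gq !permK.
have := inv _ _ lt; rewrite inv_s // !pcompE !permKV gp gq !eqxx orbT.
exact.
Qed.

Lemma translate_down i gamma : gamma \in I -> i \in DesL gamma ->
  leL (pcomp sigma u) (pcomp (sref i) (pcomp gamma u)) -> leL sigma (pcomp (sref i) gamma).
Proof.
move=> gI iD /leLP inv; apply/leLP => p q pq sqp.
have [/leLP sg _] : leL sigma gamma /\ leL gamma rho by apply/andP; rewrite -in_intervalL.
have iD' : i \notin DesL (pcomp (sref i) gamma) by rewrite DesL_s iD.
have := sg _ _ pq sqp; have := inv_s iD' pq; rewrite pcomp_sK => ->.
case/orP => // /andP [/eqP lo /eqP hi].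
have gp : gamma p = ord_hi i by rewrite -s_lo -lo -[RHS]pcompE pcomp_sK.
have gq : gamma q = ord_lo i by rewrite -s_hi -hi -[RHS]pcompE pcomp_sK.
have iDu : i \in DesL (pcomp gamma u) by rewrite Desu.
have lt : ((u^-1)%g p < (u^-1)%g q)%N.
  by have := iDu; rewrite DesLE pcompV !pcompE -gp -gq !permK.
have := inv _ _ lt; rewrite !pcompE !permKV => /(_ sqp).
by rewrite gp gq s_lo s_hi /=; lia.
Qed.

Lemma translate_onto z : leL sigma rho -> leL (pcomp sigma u) z -> leL z (pcomp rho u) ->
  pcomp z u^-1%g \in I.
Proof.
have uK x : pcomp (pcomp x u) u^-1%g = x by rewrite /pcomp mulgA mulVg mul1g.
have uVK x : pcomp (pcomp x u^-1%g) u = x by rewrite /pcomp mulgA mulgV mul1g.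
move=> sr sz; elim/leL_ind: z / sz => [|z i sz iz IH] zr.
  by rewrite uK in_intervalL leL_refl.
have {IH}zI := IH (leL_trans (leL_s iz) zr).
have Dz : DesL z = DesL (pcomp z u^-1%g) by rewrite -(Desu zI) uVK.
rewrite -pcompA in_intervalL translate_up -?Dz ?uVK // andbT.
rewrite in_intervalL in zI; case/andP: zI => sg _.
by apply: leL_trans sg _; apply: leL_s; rewrite -Dz.
Qed.

End Translation.

(** * The cover obtained from a translation that preserves descents *)

Section Cover.

Variables (K : fieldType) (n : nat) (sigma rho u : 'S_n) (A : {set 'I_n.-1}).
Local Notation H := (H0 K n).
Local Notation I := (intervalL sigma rho).

Hypothesis sr : leL sigma rho.
Hypothesis Desu : forall gamma, gamma \in I -> DesL (pcomp gamma u) = DesL gamma.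
Hypothesis su : pcomp sigma u = w0 A.

Let T := DesR (pcomp rho u).
Local Notation J := (intervalL (w0 A) (w1 T)).
Local Notation N := (Bmod K sigma rho).
Local Notation P := (Bmod K (w0 A) (w1 T)).

Let uK x : pcomp (pcomp x u) u^-1%g = x. Proof. by rewrite /pcomp mulgA mulVg mul1g. Qed.
Let uVK x : pcomp (pcomp x u^-1%g) u = x. Proof. by rewrite /pcomp mulgA mulgV mul1g. Qed.

Let AT : A \subset T.
Proof. by rewrite -leL_w0 -su; apply: (leL_translate Desu) => //; apply: leL_refl. Qed.

Let translate_in gamma : gamma \in I -> pcomp gamma u \in J.
Proof.
rewrite !in_intervalL => /andP [sg gr]; rewrite -su (leL_translate Desu) ?leL_refl //=.
apply: leL_trans (_ : leL _ (pcomp rho u)) _; last by rewrite leL_w1.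
by apply: (leL_translate Desu) => //; apply: leL_refl.
Qed.

Let F (z : 'S_n) : N := bvec K sigma rho (pcomp z u^-1%g).

(** [F] is zero off the translate of [I]. An ascending step in [J] that starts off the translate
    stays off it, by [translate_down], so [F] respects the action there too. *)
Lemma quotient_gen i z : z \in J -> H0gen K i *: F z =
  if i \in DesL z then F z
  else if pcomp (sref i) z \in J then F (pcomp (sref i) z) else 0.
Proof.
move=> zJ; have [zI|zI] := boolP (pcomp z u^-1%g \in I).
  have <- : DesL (pcomp z u^-1%g) = DesL z by rewrite -(Desu zI) uVK.
  rewrite gen_bvec //; case: ifPn => // iD; rewrite /F -pcompA.
  case: ifPn => // sJ; rewrite bvec_out //; apply: contra sJ => /translate_in.
  by rewrite -pcompA uVK.
rewrite {1 2}/F (bvec_out _ zI) scaler0.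
case: ifPn => // iD; case: ifPn => // sJ; rewrite /F bvec_out // -pcompA.
apply: contra zI => sI; have e := pcomp_sK i (pcomp z u^-1%g).
have iD' : i \in DesL (pcomp (sref i) (pcomp z u^-1%g)).
  by rewrite -(Desu sI) -pcompA uVK DesL_s.
rewrite -e in_intervalL (translate_down Desu) //=.
  by move: (sI); rewrite in_intervalL => /andP [_]; apply: leL_trans (leL_down iD').
by rewrite su -(pcompA _ _ u) uVK pcomp_sK; move: zJ; rewrite in_intervalL => /andP [].
Qed.

Let f : {linear P -> N} := bext_lin quotient_gen.

Lemma quotient_surj : surjective f.
Proof.
move=> w; exists (\sum_x (bcoef w x)%:A *: bvec K (w0 A) (w1 T) (pcomp (val x) u)).
rewrite linear_sum [RHS]bmod_basis; apply: eq_bigr => x _; rewrite linearZ; congr (_ *: _).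
by rewrite [LHS]bext_vec ?translate_in ?(valP x) // /F uK.
Qed.

(** If the support of $x$ is inside $T$, then $x\preceq_L w_0(T)\preceq_L\rho u$, so $x$ lies in the
    translate of [I]; its coefficient survives under [f]. *)
Lemma quotient_ker v : f v = 0 -> spanned (offT T) v.
Proof.
move=> fv x; apply: contraNN => /supp_leL xT.
have /andP [Ax xw] : leL (w0 A) (val x) && leL (val x) (w1 T) by rewrite -in_intervalL (valP x).
have xI : pcomp (val x) u^-1%g \in I.
  apply: (translate_onto Desu) => //; first by rewrite su.
  by apply: leL_trans xT _; rewrite leL_w0.
have := congr1 (fun w : N => bcoef w (exist (fun g => g \in I) _ xI)) fv; rewrite bcoef0 => <-; apply/eqP.
rewrite [f v]/(bext F v) /bext bcoef_sum (bigD1 x) //= big1 ?addr0.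
  by rewrite bcoefZ bcoef_vec eqxx mulr1.
move=> y yx; rewrite bcoefZ bcoef_vec /=; case: eqP => [e|_]; last by rewrite mulr0.
by case/eqP: yx; apply: val_inj; rewrite -(uVK (val y)) -e uVK.
Qed.

Theorem interval_cover : strong_cover N P.
Proof.
split; [exact: top_fin_gen|exact: top_projective|].
exists f; first exact: quotient_surj.
by move=> X g; apply: top_essential => //; exact: quotient_ker.
Qed.

End Cover.

(** * Duality *)

Section Dual.

Variables (K : fieldType) (n : nat).
Local Notation H := (H0 K n).
Local Notation gen := (H0gen K).
Implicit Types (i j : 'I_n.-1).

Section DualModule.

Variable X : lmodType H.

(** [X] is a module over the algebra only; the field acts on it through the scalars [a%:A]. *)
Definition K_linear (l : X -> K) : Prop :=
  forall (a : K) u v, l (a%:A *: u + v) = a * l u + l v.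

Record dual : Type := Dual { dfun :> X -> K; dfun_linear : K_linear dfun }.

Implicit Types l m : dual.

Lemma dualP l m : (forall v, l v = m v) -> l = m.
Proof.
case: l m => l lP [m mP] /= /funext e; rewrite -e in mP *.
by congr Dual; apply: Prop_irrelevance.
Qed.

HB.instance Definition _ := gen_eqMixin dual.
HB.instance Definition _ := gen_choiceMixin dual.

Lemma dfunZ l (a : K) v : l (a%:A *: v) = a * l v.
Proof.
have h := dfun_linear l; have := h (-1) 0 0.
rewrite scaler0 addr0 mulN1r addNr => l0.
by have := h a v 0; rewrite !addr0 l0 addr0.
Qed.

Lemma dfunD l u v : l (u + v) = l u + l v.
Proof. by have := dfun_linear l 1 u v; rewrite !scale1r mul1r. Qed.

Lemma dfun0 l : l 0 = 0.
Proof. by apply: (addrI (l 0)); rewrite -dfunD !addr0. Qed.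

Lemma dfunN l v : l (- v) = - l v.
Proof. by apply: (addrI (l v)); rewrite -dfunD !subrr dfun0. Qed.

Lemma dfun_sum l (L : Type) (r : seq L) (P : pred L) (F : L -> X) :
  l (\sum_(k <- r | P k) F k) = \sum_(k <- r | P k) l (F k).
Proof. by elim/big_rec2: _ => [|k a b _ <-]; rewrite ?dfun0 ?dfunD. Qed.

Lemma dadd_linear l m : K_linear (fun v => l v + m v).
Proof. by move=> a u v; rewrite !dfunD !dfunZ mulrDr addrACA. Qed.

Lemma dscale_linear (c : K) l : K_linear (fun v => c * l v).
Proof. by move=> a u v; rewrite dfunD dfunZ mulrDr mulrCA. Qed.

Lemma dact_linear (h : H) l : K_linear (fun v => l (h *: v)).
Proof.
by move=> a u v; rewrite scalerDr dfunD scalerA mulr_algr -mulr_algl -scalerA dfunZ.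
Qed.

Lemma dzero_linear : K_linear (fun=> 0).
Proof. by move=> a u v; rewrite mulr0 addr0. Qed.

Definition dzero := Dual dzero_linear.
Definition dadd l m := Dual (dadd_linear l m).
Definition dscale c l := Dual (dscale_linear c l).
Definition dact h l := Dual (dact_linear h l).

Lemma daddA : associative dadd. Proof. by move=> x y z; apply: dualP => v /=; rewrite addrA. Qed.
Lemma daddC : commutative dadd. Proof. by move=> x y; apply: dualP => v /=; rewrite addrC. Qed.
Lemma dadd0 : left_id dzero dadd. Proof. by move=> x; apply: dualP => v /=; rewrite add0r. Qed.
Lemma daddN : left_inverse dzero (dscale (-1)) dadd.
Proof. by move=> x; apply: dualP => v /=; rewrite mulN1r addNr. Qed.

HB.instance Definition _ := GRing.isZmodule.Build dual daddA daddC dadd0 daddN.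

Lemma dscaleA a b l : dscale a (dscale b l) = dscale (a * b) l.
Proof. by apply: dualP => v /=; rewrite mulrA. Qed.
Lemma dscale1 : left_id 1 dscale. Proof. by move=> l; apply: dualP => v /=; rewrite mul1r. Qed.
Lemma dscaleDr : right_distributive dscale +%R.
Proof. by move=> a x y; apply: dualP => v /=; rewrite mulrDr. Qed.
Lemma dscaleDl l : {morph dscale^~ l : a b / a + b}.
Proof. by move=> a b; apply: dualP => v /=; rewrite mulrDl. Qed.

HB.instance Definition _ := GRing.Zmodule_isLmodule.Build K dual
  dscaleA dscale1 dscaleDr dscaleDl.

Lemma dual_relations : H0_relations (fun i => dact (1 - gen i)).
Proof.
split=> [i a l m|i l|i j l ij|i j l ij]; apply: dualP => v //=; rewrite !scalerA.
- by rewrite genC_idem.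
- by rewrite genC_braid.
- by case/orP: ij => ij; rewrite (genC_comm _ ij).
Qed.

(* Transposing a left module gives a right module; the anti-automorphism      *)
(* pi_i |-> 1 - pi_i turns it back into a left one.                           *)
Definition dualM : lmodType H := hmod dual_relations.

Lemma dual_genE i (l : dualM) v : (gen i *: l : dual) v = (l : dual) v - (l : dual) (gen i *: v).
Proof. by rewrite hmod_genE /= scalerBl scale1r dfunD dfunN. Qed.

Lemma dual_scalE (a : K) (l : dualM) v : (a%:A *: l : dual) v = a * (l : dual) v.
Proof. by rewrite hmod_scalE. Qed.

Lemma dual_zeroE v : ((0 : dualM) : dual) v = 0.
Proof. by []. Qed.

End DualModule.

Section DualMap.

Variables (X Y : lmodType H) (f : {linear X -> Y}).

Lemma dmap_subproof (l : dualM Y) : K_linear (fun v => (l : dual Y) (f v)).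
Proof. by move=> a u v; rewrite linearP dfun_linear. Qed.

Definition dmap (l : dualM Y) : dualM X := Dual (dmap_subproof l).

Lemma dmap_is_linear : linear dmap.
Proof.
apply: linear_gen => [l m|a l|i l]; apply: dualP => v /=.
- by [].
- by rewrite !dual_scalE.
- by rewrite !dual_genE /= linearZ.
Qed.

HB.instance Definition _ := GRing.isLinear.Build H (dualM Y) (dualM X) *:%R dmap dmap_is_linear.

End DualMap.

End Dual.

(** * Extension of functionals from submodules *)

Section Extension.

Variables (K : fieldType) (n : nat).
Local Notation H := (H0 K n).
Local Notation gen := (H0gen K).

(** The span of the $\pi_z$ contains 1 and is stable under left multiplication by generators. *)
Lemma H0_span (h : H) : exists c : 'S_n -> K, h = \sum_z (c z)%:A * pi K z.
Proof.
pose S (u : H) := exists c : 'S_n -> K, u = \sum_z (c z)%:A * pi K z.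
have S_pi z : S (pi K z).
  exists (fun y => (y == z)%:R); rewrite (bigD1 z) //= eqxx scale1r mul1r big1 ?addr0 //.
  by move=> y /negPf ->; rewrite scale0r mul0r.
have SZ a u : S u -> S (a%:A * u).
  case=> c ->; exists (fun z => a * c z); rewrite mulr_sumr; apply: eq_bigr => z _.
  by rewrite mulrA -scalerAl mul1r scalerA.
have SD u v : S u -> S v -> S (u + v).
  case=> c -> [d ->]; exists (fun z => c z + d z); rewrite -big_split.
  by apply: eq_bigr => z _; rewrite /= scalerDl mulrDl.
suff : forall u, S u -> S (h * u) by move/(_ 1); rewrite mulr1; apply; rewrite -(pi1 K n).
elim/H0_ind: h => [a|i|x y IHx IHy|x y IHx IHy] u Su.
- exact: SZ.
- case: Su => c ->; rewrite mulr_sumr.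
  elim/big_ind: _ => [|x y|z _]; [|exact: SD|].
    by exists (fun=> 0); rewrite big1 // => z _; rewrite scale0r mul0r.
  rewrite mulrA mulr_algr -mulr_algl -mulrA; apply: SZ.
  have [iz|iz] := boolP (i \in DesL z); first by rewrite pi_DesL.
  by rewrite -pi_s.
- by rewrite mulrDl; apply: SD; [apply: IHx|apply: IHy].
- by rewrite -mulrA; apply/IHx/IHy.
Qed.

Section Graphs.

Variable Y : lmodType H.
Implicit Types (G : Y -> K -> Prop) (y u v w : Y) (a b c : K).

(** The graph of a $K$-linear functional defined on a subspace of [Y]; the domain is implicit, so
    vectors can be adjoined one at a time. *)
Definition functional_graph G : Prop :=
  [/\ G 0 0, forall a, G 0 a -> a = 0 &
      forall c u a v b, G u a -> G v b -> G (c%:A *: u + v) (c * a + b)].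

Lemma graph_adjoin G y : functional_graph G -> exists G',
  [/\ functional_graph G', forall u a, G u a -> G' u a & exists a, G' y a].
Proof.
move=> [G0 Gu Gl].
have [[a Gy]|noy] := pselect (exists a, G y a); first by exists G; split=> //; exists a.
(* The new vector [y] receives the value 0. *)
exists (fun u a => exists c w, u = c%:A *: y + w /\ G w a); split; first split.
- by exists 0, 0; rewrite !scale0r addr0.
- move=> a [c [w [e Gw]]]; have [c0|c0] := eqVneq c 0.
    by move: e Gw; rewrite c0 !scale0r add0r => <-; apply: Gu.
  case: noy; exists (- c^-1 * a + 0).
  have -> : y = (- c^-1)%:A *: w + 0; last exact: Gl.
  have -> : w = - (c%:A *: y) by apply/eqP; rewrite -addr_eq0 addrC -e.
  by rewrite addr0 scalerN scalerA -scalerAl mul1r scalerA mulNr mulVf // !scaleN1r opprK.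
- move=> c u a v b [c1 [w1 [-> G1]]] [c2 [w2 [-> G2]]].
  exists (c * c1 + c2), (c%:A *: w1 + w2); split; last exact: Gl.
  by rewrite scalerDr addrACA !scalerDl scalerA -scalerAl mul1r scalerA.
- by move=> u a Gua; exists 0, u; rewrite !scale0r add0r.
- by exists 0, 1%R, 0; rewrite !scale1r addr0.
Qed.

Lemma graph_adjoin_all G (I : finType) (y : I -> Y) : functional_graph G -> exists G',
  [/\ functional_graph G', forall u a, G u a -> G' u a & forall i, exists a, G' (y i) a].
Proof.
move=> Gf; suff [G' [Gf' GG' G'y]] : exists G', [/\ functional_graph G',
    forall u a, G u a -> G' u a & forall i, i \in enum I -> exists a, G' (y i) a].
  by exists G'; split=> // i; apply: G'y; rewrite mem_enum.
elim: (enum I) => [|i s [G1 [Gf1 GG1 G1s]]]; first by exists G.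
have [G2 [Gf2 G12 [a G2y]]] := graph_adjoin (y i) Gf1.
exists G2; split=> // [u b /GG1 /G12 //|j]; rewrite in_cons => /orP [/eqP ->|/G1s [b G1y]].
  by exists a.
by exists b; apply: G12.
Qed.

Lemma graph_total G : functional_graph G -> (forall u, exists a, G u a) ->
  exists l : dual Y, forall u a, G u a -> l u = a.
Proof.
move=> [G0 Gu Gl] Gt; have Gf u a b : G u a -> G u b -> b = a.
  move=> Ga Gb; have := Gl (-1) _ _ _ _ Ga Gb; rewrite !scaleN1r addNr mulN1r.
  by move/Gu/eqP; rewrite addrC subr_eq0 => /eqP.
pose l u := projT1 (cid (Gt u)); have lP u : G u (l u) := projT2 (cid (Gt u)).
have l_lin : K_linear l by move=> c u v; apply: Gf (lP _); apply: Gl.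
by exists (Dual l_lin) => u a Ga; apply: Gf Ga (lP u).
Qed.

End Graphs.

(** By [H0_span] a finitely generated [Y] is spanned over [K] by finitely many vectors. Adjoining
    these extends the functional that [l] induces on the image of [f]. *)
Lemma dmap_surjective (X Y : lmodType H) (f : {linear X -> Y}) :
  fin_gen Y -> injective f -> surjective (dmap f).
Proof.
move=> [k [g gY]] finj l.
pose G y a := exists2 x, y = f x & a = (l : dual X) x.
have Gf : functional_graph G.
  split; first by exists 0; rewrite ?linear0 ?dfun0.
    by move=> a [x]; rewrite -[LHS](linear0 f) => /finj <- ->; rewrite dfun0.
  move=> c _ _ _ _ [x -> ->] [x' -> ->]; exists (c%:A *: x + x'); first by rewrite linearP.
  by rewrite dfun_linear.
have [G' [Gf' GG' G'g]] :=
  graph_adjoin_all (fun p : 'S_n * 'I_k => pi K p.1 *: g p.2) Gf.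
have [G0' _ Gl'] := Gf'.
have G'D u v : (exists a, G' u a) -> (exists a, G' v a) -> exists a, G' (u + v) a.
  by move=> [a Ga] [b Gb]; exists (1 * a + b); rewrite -[u]scale1r -[1](scale1r (1 : H)); apply: Gl'.
have G'sum (L : finType) (F : L -> Y) : (forall j, exists a, G' (F j) a) ->
    exists a, G' (\sum_j F j) a.
  by move=> GF; elim/big_ind: _ => //; exists 0.
have [|m mP] := graph_total Gf'.
  move=> u; have [c ->] := gY u; apply: (G'sum) => j; have [d ->] := H0_span (c j).
  rewrite scaler_suml; apply: G'sum => z; have [a Ga] := G'g (z, j).
  by exists (d z * a + 0); rewrite -[_ *: _]addr0 -scalerA; apply: Gl'.
exists m; apply: dualP => x /=.
by apply: mP; apply: GG'; exists x.
Qed.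

End Extension.

(** * The dual of an interval module *)

Section IntervalDual.

Variables (K : fieldType) (n : nat).
Implicit Types (z sigma rho : 'S_n) (i : 'I_n.-1).

Lemma wmaxK : involutive (wmax n). Proof. exact: w0K. Qed.

Definition flip z := pcomp z (wmax n).

Lemma flipK : involutive flip.
Proof. by move=> z; apply/permP => x; rewrite !pcompE wmaxK. Qed.

Lemma flip_s i z : pcomp (sref i) (flip z) = flip (pcomp (sref i) z).
Proof. exact: pcompA. Qed.

Lemma DesL_flip i z : (i \in DesL (flip z)) = (i \notin DesL z).
Proof.
rewrite !DesLE pcompV w0V !pcompE wmax_lt.
by rewrite perm_ltNge //=; lia.
Qed.

Lemma leL_flip y z : leL (flip y) (flip z) = leL z y.
Proof.
suff h a b : leL a b -> leL (flip b) (flip a).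
  by apply/idP/idP => /h //; rewrite !flipK.
elim/leL_ind => [|d i _ id IH]; first exact: leL_refl.
apply: leL_trans IH; rewrite -flip_s.
rewrite -{2}(pcomp_sK i (flip d)); apply: leL_s.
by rewrite flip_s DesL_flip DesL_s negbK.
Qed.

Lemma flip_interval sigma rho z :
  (flip z \in intervalL (flip rho) (flip sigma)) = (z \in intervalL sigma rho).
Proof. by rewrite !in_intervalL !leL_flip andbC. Qed.


Definition sgn z : K := (-1) ^+ len z.

Lemma sgnK z : sgn z * sgn z = 1.
Proof. by rewrite /sgn -expr2 sqrr_sign. Qed.

Lemma sgn_s i z : sgn (pcomp (sref i) z) = - sgn z.
Proof.
have [iD|iD] := boolP (i \in DesL z); last by rewrite /sgn len_s // exprS mulN1r.
have iD' : i \notin DesL (pcomp (sref i) z) by rewrite DesL_s iD.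
by have := len_s iD'; rewrite pcomp_sK /sgn => ->; rewrite exprS mulN1r opprK.
Qed.

Section Pairing.

Variables (sigma rho : 'S_n).
Local Notation I := (intervalL sigma rho).
Local Notation I' := (intervalL (flip rho) (flip sigma)).
Local Notation M := (Bmod K sigma rho).
Local Notation M' := (Bmod K (flip rho) (flip sigma)).
Local Notation vec := (bvec K sigma rho).
Local Notation vec' := (bvec K (flip rho) (flip sigma)).
Local Notation gen := (H0gen K).

Lemma vec_dual_linear (z : 'S_n) :
  K_linear (fun v : M => \sum_(x | val x == flip z) sgn z * bcoef v x).
Proof.
move=> a u v; rewrite mulr_sumr -big_split; apply: eq_bigr => x _ /=.
by rewrite bcoefD bcoefZ mulrDr mulrCA.
Qed.

(** For [flip z] in the interval, the dual basis vector of [flip z] up to the sign of [z]. The sign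
    absorbs the minus in [dual_genE]. *)
Definition vec_dual z : dualM M := Dual (vec_dual_linear z).

Lemma vec_dualE z g : g \in I -> (vec_dual z : dual M) (vec g) = sgn z * (g == flip z)%:R.
Proof.
move=> gI /=; have [e|ne] := eqVneq g (flip z).
  rewrite (big_pred1 (exist (fun g => g \in I) g gI)) => [|x]; first by rewrite bcoef_vec /= eqxx.
  by rewrite -val_eqE /= -e.
rewrite big1 ?mulr0 // => x /eqP xz; rewrite bcoef_vec; case: eqP => [xg|_]; last by rewrite mulr0.
by case/eqP: ne; rewrite -xg.
Qed.

Lemma dual_bvecP (l m : dual M) : (forall g, g \in I -> l (vec g) = m (vec g)) -> l = m.
Proof.
move=> lm; apply: dualP => v; rewrite [v]bmod_basis !dfun_sum; apply: eq_bigr => x _.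
by rewrite !dfunZ lm ?(valP x).
Qed.

Lemma vec_dual_gen i z : z \in I' -> gen i *: vec_dual z =
  if i \in DesL z then vec_dual z
  else if pcomp (sref i) z \in I' then vec_dual (pcomp (sref i) z) else 0.
Proof.
move=> zI; have fzI : flip z \in I by rewrite -flip_interval flipK.
apply: dual_bvecP => g gI; rewrite dual_genE gen_bvec // vec_dualE //.
have -> : (vec_dual z : dual M) (if i \in DesL g then vec g else vec (pcomp (sref i) g)) =
    sgn z * (if i \in DesL g then g == flip z else pcomp (sref i) g == flip z)%:R.
  case: ifPn => iD; first by rewrite vec_dualE.
  have [sI|sI] := boolP (pcomp (sref i) g \in I); first by rewrite vec_dualE.
  rewrite (bvec_out _ sI) dfun0; case: eqP => [e|_]; last by rewrite mulr0.
  by rewrite e fzI in sI.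
have sflip : (pcomp (sref i) g == flip z) = (g == flip (pcomp (sref i) z)).
  by rewrite -flip_s (inv_eq (pcomp_sK i)).
have D1 y : i \in DesL g -> i \in DesL y -> (g == flip y) = false.
  by move=> ig iy; apply/negP => /eqP e; move: ig; rewrite e DesL_flip iy.
have D2 y : i \notin DesL g -> i \notin DesL y -> (g == flip y) = false.
  by move=> ig iy; apply/negP => /eqP e; move: ig; rewrite e DesL_flip iy.
have [iz|iz] := boolP (i \in DesL z); have [ig|ig] := boolP (i \in DesL g).
- by rewrite (vec_dualE z gI) D1 // mulr0 subr0.
- have sz : i \notin DesL (pcomp (sref i) z) by rewrite DesL_s iz.
  by rewrite (vec_dualE z gI) sflip (D2 _ ig sz) mulr0 subr0.
- have sz : i \in DesL (pcomp (sref i) z) by rewrite DesL_s.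
  rewrite subrr; case: ifPn => [sI|_]; last by rewrite dual_zeroE.
  by rewrite (vec_dualE _ gI) (D1 _ ig sz) mulr0.
rewrite D2 // mulr0 sub0r sflip; case: ifPn => [sI|sI].
  by rewrite (vec_dualE _ gI) sgn_s mulNr.
rewrite dual_zeroE; case: eqP => [e|_]; last by rewrite mulr0 oppr0.
by case/negP: sI; rewrite -[X in X \in _]flipK flip_interval -e.
Qed.

Definition to_dual : {linear M' -> dualM M} := bext_lin vec_dual_gen.

Lemma to_dual_vec z : z \in I' -> to_dual (vec' z) = vec_dual z.
Proof. exact: bext_vec. Qed.

Lemma to_dual_inj : injective to_dual.
Proof.
move=> u v e; apply: bcoefP => x.
suff coefE w : bcoef w x = sgn (val x) * (to_dual w : dual M) (vec (flip (val x))).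
  by rewrite !coefE e.
have xI : flip (val x) \in I by rewrite -flip_interval flipK (valP x).
have sum_dual (L : finType) (F : L -> dualM M) y :
    (\sum_l F l : dual M) y = \sum_l (F l : dual M) y.
  by elim/big_rec2: _ => // l a b _ <-.
rewrite [to_dual w]/(bext vec_dual w) /bext sum_dual (bigD1 x) //= big1 ?addr0 => [|y yx].
  by rewrite dual_scalE vec_dualE // eqxx mulr1 mulrCA sgnK mulr1.
rewrite dual_scalE vec_dualE // (inj_eq (inv_inj flipK)) val_eqE eq_sym (negPf yx).
by rewrite !mulr0.
Qed.

Lemma to_dual_surj : surjective to_dual.
Proof.
move=> l; pose x' (x : {g | g \in I}) := flip (val x).
exists (\sum_(x : {g | g \in I}) (sgn (x' x) * (l : dual M) (vec (val x)))%:A *: vec' (x' x)).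
rewrite linear_sum; apply: dual_bvecP => g gI.
have sum_dual (L : finType) (F : L -> dualM M) y :
    (\sum_l F l : dual M) y = \sum_l (F l : dual M) y.
  by elim/big_rec2: _ => // k a b _ <-.
rewrite sum_dual (bigD1 (exist (fun g => g \in I) g gI)) // big1 ?addr0 => [|x /andP [_ xg]].
  rewrite linearZ dual_scalE to_dual_vec ?flip_interval // vec_dualE // flipK eqxx mulr1.
  by rewrite [LHS]addr0 mulrAC sgnK mul1r.
rewrite linearZ dual_scalE to_dual_vec ?flip_interval ?(valP x) // vec_dualE // flipK.
by rewrite eq_sym -[g]/(val (exist (fun g => g \in I) g gI)) val_eqE (negPf xg) !mulr0.
Qed.

Lemma to_dual_separates (u v : M) :
  (forall w, (to_dual w : dual M) u = (to_dual w : dual M) v) -> u = v.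
Proof.
move=> e; apply: bcoefP => x.
suff coefE w : bcoef w x = sgn (flip (val x)) * (vec_dual (flip (val x)) : dual M) w.
  by rewrite !coefE -to_dual_vec ?flip_interval ?(valP x) // e.
by rewrite /= flipK (big_pred1 x) // mulrA sgnK mul1r.
Qed.

(** The pairing of [M'] with [M] given by [to_dual] is perfect, so [t y] is found by its coordinates
    and is unique by [to_dual_separates], which gives linearity. *)
Lemma transpose (X : lmodType (H0 K n)) (k : {linear M' -> dualM X}) :
  exists t : {linear X -> M}, forall w y, (to_dual w : dual M) (t y) = (k w : dual X) y.
Proof.
have sum_dual (Z : lmodType (H0 K n)) (F : {g | g \in I'} -> dualM Z) y :
    (\sum_l F l : dual Z) y = \sum_l (F l : dual Z) y.
  by elim/big_rec2: _ => // l a b _ <-.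
have ex y : exists e : M, forall w, (to_dual w : dual M) e = (k w : dual X) y.
  exists (\sum_(x : {g | g \in I})
    (sgn (flip (val x)) * (k (vec' (flip (val x))) : dual X) y)%:A *: vec (val x)) => w.
  rewrite [w]bmod_basis !linear_sum !sum_dual; apply: eq_bigr => x' _.
  rewrite !linearZ !dual_scalE to_dual_vec ?(valP x') //; congr (_ * _).
  have xI : flip (val x') \in I by rewrite -flip_interval flipK (valP x').
  rewrite dfun_sum (bigD1 (exist (fun g => g \in I) _ xI)) // big1 => [|x /andP [_ xx']].
    rewrite [LHS]addr0.
    by rewrite dfunZ vec_dualE // eqxx mulr1 flipK mulrAC sgnK mul1r.
  rewrite dfunZ vec_dualE ?(valP x) //.
  have /negPf -> : val x != flip (val x') by apply: contra xx' => /eqP e; apply/eqP/val_inj.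
  by rewrite !mulr0.
pose t y := projT1 (cid (ex y)).
have tP y w : (to_dual w : dual M) (t y) = (k w : dual X) y := projT2 (cid (ex y)) w.
have t_lin : linear t.
  apply: linear_gen => [u v|a v|i v]; apply: to_dual_separates => w.
  - by rewrite dfunD !tP dfunD.
  - by rewrite dfunZ !tP dfunZ.
  have gen_dfun (Z : lmodType (H0 K n)) (l : dualM Z) y :
      (l : dual Z) (gen i *: y) = (l : dual Z) y - (gen i *: l : dual Z) y.
    by rewrite dual_genE subKr.
  by rewrite tP !gen_dfun -!linearZ !tP.
pose tl : {linear X -> M} := HB.pack t (GRing.isLinear.Build (H0 K n) X M *:%R t t_lin).
by exists tl => w y; apply: tP.
Qed.

Lemma bmod_fin_gen : fin_gen M.
Proof.
exists #|{: {g | g \in I}}|, (fun k => vec (val (enum_val k))) => v.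
exists (fun k => (bcoef v (enum_val k))%:A).
rewrite {1}[v]bmod_basis -(big_enum_val (fun x => (bcoef v x)%:A *: vec (val x))).
exact: eq_bigl.
Qed.

End Pairing.


(** Extending along an injective [f] becomes lifting along the surjective [dmap f], and an essential
    epimorphism transposes to an essential monomorphism. *)
Theorem injective_hull_of_cover (sigma rho sigma' rho' : 'S_n) :
  strong_cover (Bmod K (flip rho) (flip sigma)) (Bmod K (flip rho') (flip sigma')) ->
  is_injective_hull (Bmod K sigma rho) (Bmod K sigma' rho').
Proof.
case=> _ proj [p psurj pess]; split; first exact: bmod_fin_gen.
  move=> X Y f g _ fgY finj.
  have [h hP] := proj _ _ (dmap f) (dmap g \o to_dual sigma' rho') (dmap_surjective fgY finj).
  have [t tP] := transpose h; exists t => x; apply: to_dual_separates => w.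
  by rewrite tP; have := congr1 (fun l : dual X => l x) (hP w).
have [f fP] := transpose (to_dual sigma rho \o p).
exists f; split.
  move=> u v e; apply: to_dual_separates => w; have [w' <-] := psurj w.
  by have := fP w' u; rewrite e fP.
move=> X g fgX gf_inj.
have ex (l : dualM X) : exists w, to_dual sigma' rho' w = dmap g l by apply: to_dual_surj.
(* [G] is [dmap g] read through the bijection [to_dual], so that the essentiality of [p] applies to
   it. *)
pose G l := projT1 (cid (ex l)); have GP l : to_dual _ _ (G l) = dmap g l := projT2 (cid (ex l)).
have G_lin : linear G by move=> a l m; apply: to_dual_inj; rewrite linearP !GP linearP.
have Gsurj : surjective G.
  pose Gl : {linear dualM X -> Bmod K (flip rho') (flip sigma')} :=
    HB.pack G (GRing.isLinear.Build (H0 K n) _ _ *:%R G G_lin).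
  apply: (pess _ Gl).
  move=> w; have [l lP] := @dmap_surjective _ _ _ _ (g \o f) fgX gf_inj (to_dual sigma rho w).
  exists l; apply: to_dual_inj; rewrite -lP; apply: dualP => m.
  by apply: etrans (esym (fP (G l) m)) _; rewrite GP.
move=> u v e; apply: to_dual_separates => w; have [l <-] := Gsurj w.
by rewrite GP /= e.
Qed.

End IntervalDual.

Local Close Scope ring_scope.

(** * Injective hulls *)

Section Reversal.

Variable n : nat.
Implicit Types (i : 'I_n.-1) (p q : 'I_n) (A B S T : {set 'I_n.-1}) (z : 'S_n).

(** The effect on indices of conjugation by $w_0$, which sends $s_i$ to $s_{n-i}$ ([w0_revset]). *)
Definition revset A : {set 'I_n.-1} := [set i | rev_ord i \in A].

Lemma wmaxE p : wmax n p = rev_ord p.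
Proof.
suff -> : wmax n = perm (@rev_ord_inj n) by rewrite permE.
apply: perm_lt_inj => x y; rewrite wmax_lt !permE /=.
by have := ltn_ord x; lia.
Qed.

Lemma wmax_lo i : wmax n (ord_lo i) = ord_hi (rev_ord i).
Proof. by rewrite wmaxE; apply: val_inj => /=; have := ltn_ord i; lia. Qed.

Lemma wmax_hi i : wmax n (ord_hi i) = ord_lo (rev_ord i).
Proof. by rewrite wmaxE; apply: val_inj => /=; have := ltn_ord i; lia. Qed.

Lemma joined_rev A p q : joined (revset A) p q = joined A (wmax n q) (wmax n p).
Proof.
apply/joinedP/joinedP => h k; rewrite ?wmaxE /= => pkq; have kn := ltn_ord k.
  rewrite -(rev_ordK k); have := h (rev_ord k); rewrite inE; apply => /=.
  by have := ltn_ord p; have := ltn_ord q; lia.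
rewrite inE; apply: h; rewrite !wmaxE /=.
by have := ltn_ord p; have := ltn_ord q; lia.
Qed.

Lemma w0_revset A : pcomp (wmax n) (pcomp (w0 A) (wmax n)) = w0 (revset A).
Proof.
have lt p q : p < q -> (pcomp (wmax n) (pcomp (w0 A) (wmax n)) q
    < pcomp (wmax n) (pcomp (w0 A) (wmax n)) p) = (w0 (revset A) q < w0 (revset A) p).
  move=> pq; have wqp : wmax n q < wmax n p by rewrite wmax_lt.
  by rewrite !pcompE wmax_lt (w0_lt _ wqp) (w0_lt _ pq) joined_rev.
by apply: leL_anti; apply/leLP => p q pq; rewrite lt.
Qed.

Lemma revsetC A : revset (~: A) = ~: revset A.
Proof. by apply/setP => i; rewrite !inE. Qed.

Lemma pcomp_wmaxK z : pcomp (wmax n) (pcomp (wmax n) z) = z.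
Proof. by apply/permP => x; rewrite !pcompE wmaxK. Qed.

Lemma flip_w1 T : flip (w1 T) = w0 (revset (~: T)).
Proof. by rewrite -w0_revset /flip /w1 -pcompA. Qed.

Lemma flip_w0 A : flip (w0 A) = w1 (revset (~: A)).
Proof. by rewrite revsetC /w1 setCK -w0_revset pcomp_wmaxK. Qed.

Lemma DesR_flip z : DesR (flip z) = revset (~: DesR z).
Proof.
apply/setP => i; rewrite !inE !pcompE wmax_lo wmax_hi.
by rewrite perm_ltNge //=; lia.
Qed.

Lemma w1V T : ((w1 T)^-1)%g = w1 (revset T).
Proof.
rewrite {1}/w1 pcompV !w0V -{1}(flipK (pcomp _ _)).
rewrite -[pcomp (w0 (~: T)) _]/(flip (w0 (~: T))) flip_w0 setCK.
by rewrite flipK.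
Qed.

End Reversal.

Theorem interval_hull (K : fieldType) (n : nat) (sigma rho u : 'S_n) (T : {set 'I_n.-1}) :
  leL sigma rho ->
  (forall gamma, gamma \in intervalL sigma rho -> DesL (pcomp gamma u) = DesL gamma) ->
  pcomp rho u = w1 T ->
  is_injective_hull (Bmod K sigma rho) (Bmod K (w0 (DesR (pcomp sigma u))) (w1 T)).
Proof.
move=> sr Desu ru; apply: injective_hull_of_cover; rewrite flip_w1 flip_w0 -DesR_flip.
(* After flipping, translation by $u$ becomes translation by $w_0uw_0$. *)
have [u' flip_u] : exists u', forall z, pcomp (flip z) u' = flip (pcomp z u).
  by exists (pcomp (wmax n) (flip u)) => z; rewrite /flip -(pcompA z) pcomp_wmaxK pcompA.
rewrite -flip_u; apply: interval_cover; first by rewrite leL_flip.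
  move=> gamma; rewrite -(flipK gamma); move: (flip gamma) => g; rewrite flip_interval => gI.
  apply/setP => i; rewrite flip_u.
  by rewrite (DesL_flip i (pcomp g u)) (DesL_flip i g) (Desu _ gI).
by rewrite flip_u ru flip_w1.
Qed.

(** * Blocks cut out by a set of indices *)

Section Blocks.

Variable n : nat.
Implicit Types (i j k : 'I_n.-1) (p q c : 'I_n) (T : {set 'I_n.-1}).

(* The index, starting from 1, of the block of c in the partition of 'I_n     *)
(* that is cut after the elements of T.                                       *)
Definition block T c : nat := #|[set k in T | k < c]|.+1.

Lemma block_le T p q : p <= q -> block T p <= block T q.
Proof.
move=> pq; rewrite ltnS; apply/subset_leq_card/subsetP => k.
by rewrite !inE => /andP [-> kp] /=; lia.
Qed.

Lemma block_lt T p q : block T p < block T q -> p < q.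
Proof. by move=> lt; rewrite ltnNge; apply/negP => /(block_le T); lia. Qed.

Lemma block_joined T p q : p < q -> joined (~: T) p q = (block T p == block T q).
Proof.
move=> pq; have sub : [set k in T | k < p] \subset [set k in T | k < q].
  by apply/subsetP => k; rewrite !inE => /andP [-> kp] /=; lia.
rewrite eqSS (subset_leqif_card sub).2; apply/joinedP/subsetP => h k.
  rewrite !inE => /andP [kT kq]; rewrite kT /= ltnNge; apply/negP => pk.
  by have := h k; rewrite pk kq inE kT => /(_ isT).
move=> /andP [pk kq]; rewrite inE; apply/negP => kT.
by have := h k; rewrite !inE kT kq /= => /(_ isT); lia.
Qed.

Lemma block_bound T c : block T c <= #|T|.+1.
Proof.
by rewrite ltnS; apply/subset_leq_card/subsetP => k; rewrite inE => /andP [].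
Qed.

Lemma w0_block T p q : p < q -> (w0 (~: T) q < w0 (~: T) p) = (block T p == block T q).
Proof. by move=> pq; rewrite w0_lt // block_joined. Qed.

Lemma w1_block T p q : p < q -> (w1 T p < w1 T q) = (block T p == block T q).
Proof. by move=> pq; rewrite w1_lt // block_joined. Qed.

Lemma sorted_nth_lt (s : seq nat) (c j : nat) : sorted ltn s ->
  (j < count (fun m => m < c) s) = (j < size s) && (nth 0 s j < c).
Proof.
elim: s j => [|a s IH] //= j sa; have s_sorted := path_sorted sa.
have [ac|ca] := ltnP a c; first by case: j => [|j] //=; rewrite add1n ltnS IH.
have -> : count (fun m => m < c) s = 0.
  apply/eqP; rewrite -leqn0 leqNgt -has_count; apply/negP => /hasP [k ks kc].
  by have /allP /(_ k ks) /= := order_path_min ltn_trans sa; lia.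
case: j => [|j] /=; first by lia.
rewrite addn0 ltn0; apply/esym/negP => /andP [js lt].
by have /allP /(_ _ (mem_nth 0 js)) /= := order_path_min ltn_trans sa; lia.
Qed.

Lemma cuts_le T (j : nat) c : j <= #|T|.+1 -> (nth 0 (cuts T) j <= c) = (j < block T c).
Proof.
case: j => [|j] jT //=; rewrite nth_rcons size_map -cardE ltnS.
have [jlt|Tj] := ltnP j #|T|; last first.
  have -> : j = #|T| by lia.
  rewrite eqxx leqNgt ltn_ord; have := block_bound T c.
  by rewrite /block ltnS leqNgt => /negPf ->.
have -> : #|[set k in T | k < c]| = count (fun m => m < c) [seq val k | k <- enum T].
  rewrite count_map cardE -size_filter; congr size.
  rewrite /enum_mem -filter_predI; apply: eq_filter => k /=.
  by rewrite !inE andbC.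
have srt : sorted ltn [seq val k | k <- enum T].
  rewrite sorted_map /enum_mem; apply: sorted_filter; first by move=> a b d; apply: ltn_trans.
  by have := iota_ltn_sorted 0 n.-1; rewrite -val_enum_ord sorted_map enumT.
rewrite sorted_nth_lt // size_map -cardE jlt /=.
have -> : [seq (val k).+1 | k <- enum T] = [seq m.+1 | m : nat <- [seq val k | k <- enum T]].
  by rewrite -map_comp.
by rewrite (nth_map 0) // size_map -cardE.
Qed.

End Blocks.

(** * Diagrams *)

Section CutSets.

Variable n : nat.
Implicit Types (i k : 'I_n.-1) (c : 'I_n) (T : {set 'I_n.-1}).

Lemma in_blockE T (j : nat) c : 0 < j <= #|T|.+1 -> in_block T j c = (block T c == j).
Proof.
case: j => // j jT; rewrite /in_block [j.+1.-1]/= ltnS cuts_le; last exact: ltnW.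
by rewrite [X in _ && X]ltnNge cuts_le //; lia.
Qed.

Lemma card_below (m : nat) : m <= n -> #|[set c : 'I_n | c < m]| = m.
Proof.
move=> mn; rewrite cardsE cardE size_filter -(count_map val (fun x => x < m)) -enumT val_enum_ord.
rewrite -(subnKC mn) iotaD count_cat (@eq_in_count _ _ predT) ?count_predT ?size_iota.
  rewrite (@eq_in_count _ _ pred0) ?count_pred0 ?addn0 // => x.
  by rewrite mem_iota /=; lia.
by move=> x; rewrite mem_iota /=; lia.
Qed.

(** The first [k] blocks together form the initial segment that ends at the [k]-th cut, so their
    total size is the [k]-th element of [T], shifted by one. *)
Lemma block_card T i :
  (exists2 k, 0 < k <= #|T| & i.+1 = #|[set c : 'I_n | block T c <= k]|) <-> i \in T.
Proof.
split=> [[k _ ek]|iT].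
  have iin : block T (ord_lo i) <= k.
    rewrite leqNgt; apply/negP => lt; have : i.+1 <= #|[set c : 'I_n | c < i]|.
      rewrite ek; apply/subset_leq_card/subsetP => c; rewrite !inE => ck.
      by apply: (@block_lt _ T c (ord_lo i)); apply: leq_ltn_trans lt.
    by rewrite card_below ?ltnn //; have := ltn_ord i; lia.
  have hin : k < block T (ord_hi i).
    rewrite ltnNge; apply/negP => le; have : #|[set c : 'I_n | c < i.+2]| <= i.+1.
      rewrite ek; apply/subset_leq_card/subsetP => c; rewrite !inE => ck.
      by apply: leq_trans le; apply: block_le => /=; lia.
    by rewrite card_below ?ltnn //; have := ltn_ord i; lia.
  apply: contraLR (leq_ltn_trans iin hin) => iT; rewrite -leqNgt leq_eqVlt eq_sym.
  rewrite -block_joined /= ?ltnSn //; apply/orP; left; apply/joinedP => j /= ij.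
  by have -> : j = i; [apply: val_inj => /=; lia|rewrite inE].
have lt c : (block T c <= block T (ord_lo i)) = (c < i.+1).
  apply/idP/idP => [|ci]; last exact: block_le.
  apply: contraLR; rewrite -leqNgt -ltnNge => ic.
  have le := @block_le _ T (ord_lo i) c (ltnW ic); rewrite ltn_neqAle le andbT.
  rewrite -block_joined //; apply/joinedP => h; have := h i.
  by rewrite inE iT /= leqnn ic => /(_ isT).
exists (block T (ord_lo i)).
  rewrite {1}/block /=; apply: (@leq_trans #|i |: [set k in T | k < ord_lo i]|).
    by rewrite cardsU1 inE /= ltnn andbF.
  apply/subset_leq_card/subsetP => k; rewrite in_setU1 => /orP [/eqP ->//|].
  by rewrite inE => /andP [].
rewrite (eq_card (B := [set c : 'I_n | c < i.+1])) ?card_below //; last by move=> c; rewrite !inE lt.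
by have := ltn_ord i; lia.
Qed.

End CutSets.

(** * Reading orders of the boxes *)

Section Reading.

Variables (n : nat) (D : {fset nat * nat}) (box : 'I_n -> nat * nat).
Hypothesis box_inj : injective box.
Hypothesis mem_D : forall b : nat * nat, (b \in D) = [exists p, b == box p].
Hypothesis box_pos : forall p, (0 < (box p).1) && (0 < (box p).2).
Implicit Types (tau : 'S_n).

Lemma perm_boxes : perm_eq D (map box (enum 'I_n)).
Proof.
apply: uniq_perm; [exact: fset_uniq|by rewrite map_inj_uniq ?enum_uniq|move=> b].
apply/idP/mapP => [|[p _ ->]]; rewrite mem_D.
  by case/existsP => p /eqP ->; exists p; rewrite ?mem_enum.
by apply/existsP; exists p.
Qed.

Lemma count_boxes (P : pred (nat * nat)) : count P D = #|[set p | P (box p)]|.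
Proof.
have /seq.permP -> := perm_boxes; rewrite count_map cardsE cardE size_filter enumT.
by apply: eq_count.
Qed.

Lemma box_bound p : (box p).1 <= ncols D /\ (box p).2 <= nrows D.
Proof.
have pD : box p \in D by rewrite mem_D; apply/existsP; exists p.
by split; [apply: (leq_bigmax_seq (F := fun b => b.1)) pD isT
  |apply: (leq_bigmax_seq (F := fun b => b.2)) pD isT].
Qed.

Definition lexr (c1 c2 : nat * nat -> nat) (r1 r2 : rel nat) : rel (nat * nat) :=
  fun b b' => r1 (c1 b) (c1 b') || (c1 b == c1 b') && r2 (c2 b) (c2 b').

Lemma lexr_trans c1 c2 r1 r2 : transitive r1 -> transitive r2 -> transitive (lexr c1 c2 r1 r2).
Proof.
move=> t1 t2 y x z; rewrite /lexr.
case/orP => [xy|/andP [/eqP xy xy2]] /orP [yz|/andP [/eqP yz yz2]].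
- by rewrite (t1 _ _ _ xy yz).
- by rewrite -yz xy.
- by rewrite xy yz.
- by rewrite xy yz eqxx (t2 _ _ _ xy2 yz2) orbT.
Qed.

Lemma lexr_irr c1 c2 r1 r2 : irreflexive r1 -> irreflexive r2 -> irreflexive (lexr c1 c2 r1 r2).
Proof. by move=> i1 i2 x; rewrite /lexr i1 i2 andbF. Qed.

Lemma pairwise_allpairs (r : rel (nat * nat)) (f : nat -> nat -> nat * nat) (ra rb : rel nat) (xs ys : seq nat) :
  (forall a a' b b', ra a a' -> r (f a b) (f a' b')) ->
  (forall a b b', rb b b' -> r (f a b) (f a b')) ->
  pairwise ra xs -> pairwise rb ys -> pairwise r [seq f a b | a <- xs, b <- ys].
Proof.
move=> fa fb + rys; elim: xs => [|a xs IH] //= /andP [axs /IH IHx].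
rewrite pairwise_cat IHx andbT; apply/andP; split; last first.
  rewrite pairwise_map; apply: sub_pairwise rys => b b'; exact: fb.
apply/allrelP => _ _ /mapP [b _ ->] /allpairsP [[a' b'] /= [a'xs _ ->]].
by apply: fa; have /allP := axs; apply.
Qed.

(** Both lists are sorted for the strict order [r] and have the same elements. *)
Lemma reading (r : rel (nat * nat)) (s : seq (nat * nat)) tau :
  transitive r -> irreflexive r -> pairwise r s ->
  (forall b, b \in D -> b \in s) ->
  (forall p q, (tau^-1)%g p < (tau^-1)%g q -> r (box p) (box q)) ->
  [seq b <- s | b \in D] = [seq box (tau k) | k <- enum 'I_n].
Proof.
move=> tr ir rs Ds tau_r; apply: (irr_sorted_eq tr ir).
- by rewrite sorted_pairwise // pairwise_filter.
- rewrite sorted_map; apply: (@sub_sorted _ (relpre val ltn)).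
    by move=> x y /= xy; apply: tau_r; rewrite !permK.
  by have := iota_ltn_sorted 0 n; rewrite -val_enum_ord sorted_map.
move=> b; rewrite mem_filter; apply/andP/mapP => [[]|[k _ ->]].
  rewrite mem_D => /existsP [p /eqP ->] _; exists ((tau^-1)%g p); rewrite ?mem_enum //.
  by rewrite permKV.
have bD : box (tau k) \in D by rewrite mem_D; apply/existsP; exists (tau k).
by split=> //; apply: Ds.
Qed.

Let ltn_pw k : pairwise ltn (iota 1 k).
Proof. by rewrite -sorted_pairwise ?iota_ltn_sorted //; apply: ltn_trans. Qed.

Let gtn_trans : transitive gtn. Proof. by move=> x y z /= yx zx; lia. Qed.

Let gtn_pw k : pairwise gtn (rev (iota 1 k)).
Proof. by rewrite -sorted_pairwise // rev_sorted iota_ltn_sorted. Qed.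

Let in_xs b : b \in D -> b.1 \in iota 1 (ncols D).
Proof.
rewrite mem_D => /existsP [p /eqP ->]; rewrite mem_iota.
by have [le _] := box_bound p; case/andP: (box_pos p) => -> _; rewrite /= add1n ltnS.
Qed.

Let in_ys b : b \in D -> b.2 \in iota 1 (nrows D).
Proof.
rewrite mem_D => /existsP [p /eqP ->]; rewrite mem_iota.
by have [_ le] := box_bound p; case/andP: (box_pos p) => _ ->; rewrite /= add1n ltnS.
Qed.

Lemma order_downE tau :
  (forall p q, (tau^-1)%g p < (tau^-1)%g q -> lexr fst snd ltn gtn (box p) (box q)) ->
  order_down D = [seq box (tau k) | k <- enum 'I_n].
Proof.
apply: reading; [exact: lexr_trans ltn_trans gtn_trans|by apply: lexr_irr => x; rewrite /= ltnn| |].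
  apply: pairwise_allpairs (ltn_pw _) (gtn_pw _) => [a a' b b'|a b b'] /= h; rewrite /lexr /=.
    by rewrite h.
  by rewrite eqxx h orbT.
by move=> [x y] bD; apply: allpairs_f; rewrite ?mem_rev; [exact: (in_xs bD)|exact: (in_ys bD)].
Qed.

Lemma order_BLE tau :
  (forall p q, (tau^-1)%g p < (tau^-1)%g q -> lexr fst snd ltn ltn (box p) (box q)) ->
  order_BL D = [seq box (tau k) | k <- enum 'I_n].
Proof.
apply: reading; [exact: lexr_trans ltn_trans ltn_trans|by apply: lexr_irr => x; rewrite /= ltnn| |].
  apply: pairwise_allpairs (ltn_pw _) (ltn_pw _) => [a a' b b'|a b b'] /= h; rewrite /lexr /=.
    by rewrite h.
  by rewrite eqxx h orbT.
by move=> [x y] bD; apply: allpairs_f; [exact: (in_xs bD)|exact: (in_ys bD)].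
Qed.

Lemma order_rightE tau :
  (forall p q, (tau^-1)%g p < (tau^-1)%g q -> lexr snd fst gtn ltn (box p) (box q)) ->
  order_right D = [seq box (tau k) | k <- enum 'I_n].
Proof.
apply: reading; [exact: lexr_trans gtn_trans ltn_trans|by apply: lexr_irr => x; rewrite /= ltnn| |].
  apply: (pairwise_allpairs (f := fun y x => (x, y))) (gtn_pw _) (ltn_pw _) => [a a' b b'|a b b'] /= h;
    rewrite /lexr /=; first by rewrite h.
  by rewrite eqxx h orbT.
by move=> [x y] bD; apply: (allpairs_f (fun y x => (x, y)));
  rewrite ?mem_rev; [exact: (in_ys bD)|exact: (in_xs bD)].
Qed.

Lemma order_LBE tau :
  (forall p q, (tau^-1)%g p < (tau^-1)%g q -> lexr snd fst ltn ltn (box p) (box q)) ->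
  order_LB D = [seq box (tau k) | k <- enum 'I_n].
Proof.
apply: reading; [exact: lexr_trans ltn_trans ltn_trans|by apply: lexr_irr => x; rewrite /= ltnn| |].
  apply: (pairwise_allpairs (f := fun y x => (x, y))) (ltn_pw _) (ltn_pw _) => [a a' b b'|a b b'] /= h;
    rewrite /lexr /=; first by rewrite h.
  by rewrite eqxx h orbT.
by move=> [x y] bD; apply: (allpairs_f (fun y x => (x, y)));
  [exact: (in_ys bD)|exact: (in_xs bD)].
Qed.

Lemma perm_of_wordK (z : 'S_n) : perm_of_word n (word z) = z.
Proof.
rewrite /perm_of_word; case: pickP => [y /eqP /= e|/(_ z)]; last by rewrite eqxx.
apply/permP => x; apply: val_inj.
have nth_word (w : 'S_n) : nth 0 (word w) x = (w x).+1.
  by rewrite (nth_map x) ?size_enum_ord // nth_ord_enum.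
by apply: succn_inj; rewrite -!nth_word e.
Qed.

(** The [k]-th box of the first reading belongs to position [tau1 k], whose rank in the second
    reading is its image under the inverse of [tau2]. *)
Lemma perm_of_readings tau1 tau2 (s1 s2 : seq (nat * nat)) :
  s1 = [seq box (tau1 k) | k <- enum 'I_n] -> s2 = [seq box (tau2 k) | k <- enum 'I_n] ->
  perm_of_word n [seq (index b s2).+1 | b <- s1] = pcomp tau2^-1%g tau1.
Proof.
move=> -> ->; rewrite -[RHS]perm_of_wordK -map_comp; congr perm_of_word.
apply: eq_map => k /=; congr _.+1; rewrite pcompE -[in LHS](permKV tau2 (tau1 k)).
rewrite (index_map (f := fun k => box (tau2 k))) ?index_enum_ord //.
by move=> x y /box_inj/perm_inj.
Qed.

End Reading.

Lemma sumn_counts (T : eqType) (g : T -> nat) (D : seq T) (s : seq nat) : uniq s ->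
  sumn [seq count (fun b => g b == x) D | x <- s] = count (fun b => g b \in s) D.
Proof.
elim: s => [|x s IH] /=; first by rewrite count_pred0.
case/andP => xs /IH ->; rewrite -count_predUI [X in _ + X](@eq_count _ _ pred0).
  by rewrite count_pred0 addn0; apply: eq_count => b; rewrite /= in_cons.
by move=> b /=; apply/negP => /andP [/eqP -> ]; rewrite (negPf xs).
Qed.

(* Positions are identified with boxes. The reading orders attached to an      *)
(* interval and to its translate by u differ only on strictly upper-right      *)
(* pairs; every gamma in the interval increases along such pairs, hence takes  *)
(* an intermediate value on a box in between, so such a pair never carries     *)
(* consecutive values and left descents are the same in both orders.           *)
Section NoUpperRight.

Variables (n : nat) (D : {fset nat * nat}) (box : 'I_n -> nat * nat) (sigma rho u : 'S_n).
Hypothesis mem_D : forall b : nat * nat, (b \in D) = [exists p, b == box p].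
Hypothesis no_ur : no_upper_right D.
Implicit Types (p q : 'I_n) (i : 'I_n.-1) (gamma : 'S_n).

Definition weakly_ur (b b' : nat * nat) := (b.1 <= b'.1) && (b.2 <= b'.2).
Definition strictly_ur (b b' : nat * nat) := (b.1 < b'.1) && (b.2 < b'.2).

Hypothesis box_lt : forall p q, p != q -> weakly_ur (box p) (box q) ->
  sigma p < sigma q /\ rho p < rho q.
Hypothesis box_u : forall p q, p < q -> (u^-1)%g q < (u^-1)%g p ->
  strictly_ur (box p) (box q) || strictly_ur (box q) (box p).

Lemma interval_box_lt gamma p q : gamma \in intervalL sigma rho ->
  p != q -> weakly_ur (box p) (box q) -> gamma p < gamma q.
Proof.
rewrite in_intervalL => /andP [/leLP sg /leLP gr] pq ur; have [spq rpq] := box_lt pq ur.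
case: (ltngtP p q) => [lt|lt|/val_inj e]; last by rewrite e eqxx in pq.
  by rewrite perm_ltNge ?ltn_eqF //; apply/negP => /(gr _ _ lt); lia.
exact: sg.
Qed.

Lemma no_cover gamma i : gamma \in intervalL sigma rho ->
  strictly_ur (box ((gamma^-1)%g (ord_lo i))) (box ((gamma^-1)%g (ord_hi i))) -> False.
Proof.
set p := (_ (ord_lo i)); set q := (_ (ord_hi i)) => gI ur; apply: no_ur.
exists (box p), (box q); case/andP: (ur) => ur1 ur2; split=> //.
- by rewrite mem_D; apply/existsP; exists p.
- by rewrite mem_D; apply/existsP; exists q.
move=> b; rewrite mem_D => /existsP [c /eqP ->] /andP [px xq] /andP [py yq].
have [->|cp] := eqVneq c p; first by left.
have [->|cq] := eqVneq c q; first by right.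
have pc : gamma p < gamma c.
  by apply: interval_box_lt => //; rewrite 1?eq_sym // /weakly_ur px.
have {}cq : gamma c < gamma q by apply: interval_box_lt => //; rewrite /weakly_ur xq.
by move: pc cq; rewrite !permKV /=; lia.
Qed.

Lemma no_cover_rev gamma i : gamma \in intervalL sigma rho ->
  strictly_ur (box ((gamma^-1)%g (ord_hi i))) (box ((gamma^-1)%g (ord_lo i))) -> False.
Proof.
set p := (_ (ord_lo i)); set q := (_ (ord_hi i)) => gI /andP [ur1 ur2].
have ne : q != p by apply/negP => /eqP e; rewrite e ltnn in ur1.
have : gamma q < gamma p by apply: (interval_box_lt gI ne); apply/andP; split; apply: ltnW.
by rewrite /p /q !permKV /=; lia.
Qed.

Lemma DesL_translate gamma : gamma \in intervalL sigma rho ->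
  DesL (pcomp gamma u) = DesL gamma.
Proof.
move=> gI; apply/setP => i; rewrite !DesLE pcompV !pcompE.
have nc := no_cover gI (i := i); have nr := no_cover_rev gI (i := i).
have ne := pos_neq i gamma; have neu : (u^-1)%g ((gamma^-1)%g (ord_lo i))
    != (u^-1)%g ((gamma^-1)%g (ord_hi i)) :> nat by rewrite perm_val_eq.
have bu1 := @box_u ((gamma^-1)%g (ord_lo i)) ((gamma^-1)%g (ord_hi i)).
have bu2 := @box_u ((gamma^-1)%g (ord_hi i)) ((gamma^-1)%g (ord_lo i)).
apply/idP/idP => lt; apply/negPn/negP => nlt.
  by have /orP [/nc|/nr] := bu1 ltac:(lia) lt.
by have /orP [/nr|/nc] := bu2 lt ltac:(lia).
Qed.

End NoUpperRight.

(** * The diagram of $S$ and $\rho$ *)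

Section LeftDiagram.

Variables (n : nat) (S : {set 'I_n.-1}) (rho : 'S_n).
Hypothesis S_rho : leL (w0 S) rho.
Implicit Types (p q : 'I_n).
Local Notation D := (diagram_left S rho).
Local Notation col := (block (~: S)).
Local Notation row p := (block (DesL rho) (rho p)).

Definition left_box p : nat * nat := (col p, row p).

Lemma left_mem (b : nat * nat) : (b \in D) = [exists p, b == left_box p].
Proof.
apply/imfsetP/existsP => [[_ /andP [/allpairsP [[i j] [iI jI ->]]] /existsP [r /andP []] + + ->]|[p /eqP ->]].
  rewrite !mem_iota !add1n !ltnS in iI jI; rewrite (in_blockE _ iI) (in_blockE _ jI) /=.
  move=> /eqP <- /eqP <-.
  by exists r.
exists (left_box p) => //; apply/andP; split.
  by apply: allpairs_f; rewrite mem_iota add1n ltnS block_bound.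
by apply/existsP; exists p; rewrite !in_blockE ?block_bound ?eqxx.
Qed.

Lemma left_col p q : p < q -> col p = col q -> rho q < rho p.
Proof.
by move=> pq e; apply: (leLP _ _ S_rho) => //; rewrite -(setCK S) w0_block // e.
Qed.

Lemma left_row p q : row p = row q -> rho p < rho q -> p < q.
Proof.
move=> e lt; have := block_joined (DesL rho) lt; rewrite e eqxx => /joinedP j.
rewrite -(permK rho p) -(permK rho q).
apply: (@step_lt _ (fun x => (rho^-1)%g x)) => // k /j; rewrite inE DesLE perm_ltNge //=; lia.
Qed.

(** In a column [rho] decreases with the position, since [rho] is above [w0 S]; in a row positions
    increase with values. Two positions in one box would violate one of these. *)
Lemma left_box_inj : injective left_box.
Proof.
move=> p q e; have [//|ne] := eqVneq p q; exfalso.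
have ec : col p = col q := congr1 fst e; have er : row p = row q := congr1 snd e.
clear e.
wlog lt : p q ec er ne / p < q => [hw|].
  case: (ltngtP p q) => [|lt|/val_inj e]; [exact: hw| |by rewrite e eqxx in ne].
  by apply: (hw q p) => //; rewrite eq_sym.
by have := left_row (esym er) (left_col lt ec); lia.
Qed.

Lemma left_box_lt p q : p != q -> weakly_ur (left_box p) (left_box q) ->
  w0 S p < w0 S q /\ rho p < rho q.
Proof.
move=> ne /andP [/= lec ler].
have inj : col p = col q -> row p = row q -> False.
  by move=> ec er; case/eqP: ne; apply: left_box_inj; rewrite /left_box ec er.
have nev : p != q :> nat by rewrite val_eqE.
split.
  case: (ltngtP p q) nev => // lt _.
    rewrite perm_ltNge ?ltn_eqF //; apply/negP => inv; have := inv.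
    rewrite -{1 2}(setCK S) w0_block // => /eqP ec; apply: inj => //.
    apply/eqP; rewrite eqn_leq ler /= block_le // ltnW //; exact: left_col.
  rewrite -(setCK S) w0_block // eqn_leq lec andbT.
  by apply: block_le; apply: ltnW.
rewrite ltnNge; apply/negP => le.
have lt : rho q < rho p.
  by rewrite ltn_neqAle le andbT perm_val_eq eq_sym.
have er : row p = row q by apply/eqP; rewrite eqn_leq ler block_le.
have qp := left_row (esym er) lt.
by apply: inj => //; apply/eqP; rewrite eqn_leq lec block_le // ltnW.
Qed.

(** [w1 (DesL rho)] reverses the order of the rows and keeps the order of values inside each, so the
    inverse of [left_u] ranks positions as in [order_right]. *)
Definition left_u : 'S_n := ((pcomp (w1 (DesL rho)) rho)^-1)%g.

Lemma left_uV p : (left_u^-1)%g p = w1 (DesL rho) (rho p).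
Proof. by rewrite invgK pcompE. Qed.

Lemma left_uV_lt p q : (left_u^-1)%g p < (left_u^-1)%g q ->
  lexr snd fst gtn ltn (left_box p) (left_box q).
Proof.
rewrite !left_uV /lexr /= => lt.
case: (ltngtP (rho p) (rho q)) => [pq|qp|/val_inj e]; last by rewrite e ltnn in lt.
  move: lt; rewrite w1_block // => /eqP er; rewrite er ltnn eqxx /=.
  have lt := left_row er pq; rewrite ltn_neqAle block_le ?andbT; last exact: ltnW.
  apply/negP => /eqP ec; have e := @left_box_inj p q; move: lt.
  by rewrite e ?ltnn // /left_box ec er.
rewrite ltn_neqAle block_le ?andbT; last exact: ltnW.
suff /negPf -> : row q != row p by [].
rewrite -w1_block //; lia.
Qed.

Lemma left_box_u p q : p < q -> (left_u^-1)%g q < (left_u^-1)%g p ->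
  strictly_ur (left_box p) (left_box q) || strictly_ur (left_box q) (left_box p).
Proof.
move=> pq /left_uV_lt; rewrite /lexr /strictly_ur /=.
have le := block_le (~: S) (ltnW pq).
case/orP => [lt|/andP [_ lt]]; last by lia.
rewrite lt andbT; apply/orP; left; rewrite ltn_neqAle le andbT; apply/negP => /eqP ec.
by have := left_col pq ec; have := block_lt lt; lia.
Qed.

Lemma left_w0_lt p q : ((w0 S)^-1)%g p < ((w0 S)^-1)%g q ->
  lexr fst snd ltn ltn (left_box p) (left_box q).
Proof.
rewrite w0V /lexr /= => lt.
have ne : q != p by apply/negP => /eqP e; rewrite e ltnn in lt.
have h := left_box_lt ne; rewrite /weakly_ur /= in h.
case: (ltngtP (col p) (col q)) => //= [qp|ec].
  have lqp := block_lt qp; have := w0_block (~: S) lqp; rewrite setCK.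
  by rewrite lt => /esym; lia.
by rewrite ltnNge; apply/negP => le; have [+ _] := h ltac:(lia); lia.
Qed.

Lemma left_reading :
  perm_of_word n (w_BL D (F_right D)) = pcomp (left_u^-1)%g (w0 S)^-1%g.
Proof.
rewrite w0V.
have pos p : (0 < (left_box p).1) && (0 < (left_box p).2) by [].
apply: (perm_of_readings left_box_inj).
  exact: (order_BLE left_mem pos left_w0_lt).
exact: (order_rightE left_mem pos left_uV_lt).
Qed.

Lemma left_top : pcomp rho left_u = w1 (revset (DesL rho)).
Proof.
rewrite /left_u pcompV w1V pcompA -[RHS](mulg1 _); congr (_ * _)%g.
exact: mulVg.
Qed.

End LeftDiagram.

(** * Compositions of row and column sizes *)

Section CutComposition.

Variables (n : nat) (n_gt0 : 0 < n) (D : {fset nat * nat}) (box : 'I_n -> nat * nat).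
Hypothesis box_inj : injective box.
Hypothesis mem_D : forall b : nat * nat, (b \in D) = [exists p, b == box p].
Variables (T : {set 'I_n.-1}) (z : 'S_n) (g : nat * nat -> nat).
Hypothesis g_box : forall p, g (box p) = block T (z p).

Lemma card_perm (P : pred 'I_n) : #|[set p | P (z p)]| = #|[set c | P c]|.
Proof.
rewrite -(card_imset _ (@perm_inj _ z)); apply: eq_card => c; rewrite inE.
apply/imsetP/idP => [[p]|Pc]; first by rewrite inE => Pp ->.
by exists ((z^-1)%g c); rewrite ?inE permKV.
Qed.

Lemma max_block : \max_(b <- D) g b = #|T|.+1.
Proof.
apply/eqP; rewrite eqn_leq; apply/andP; split.
  apply/bigmax_leqP_seq => b bD _; move: bD; rewrite mem_D => /existsP [p /eqP ->].
  by rewrite g_box block_bound.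
have n1 : n.-1 < n by lia.
pose p := (z^-1)%g (Ordinal n1).
have <- : g (box p) = #|T|.+1.
  rewrite g_box permKV /block; congr _.+1; apply: eq_card => k.
  by rewrite inE /= ltn_ord andbT.
by apply: (leq_bigmax_seq (F := g)) => //; rewrite mem_D; apply/existsP; exists p.
Qed.

Lemma sum_blocks (s : seq nat) : uniq s ->
  sumn [seq count (fun b => g b == x) D | x <- s] = #|[set c | block T c \in s]|.
Proof.
move=> us; rewrite sumn_counts // (count_boxes box_inj mem_D) -(card_perm (fun c => block T c \in s)).
by apply: eq_card => p; rewrite !inE g_box.
Qed.

Lemma set_of_comp_up :
  set_of_comp n [seq count (fun b => g b == x) D | x <- iota 1 (\max_(b <- D) g b)] = T.
Proof.
apply/setP => i; rewrite inE max_block size_map size_iota /=.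
have sumE k : k <= #|T| ->
    sumn (take k [seq count (fun b => g b == x) D | x <- iota 1 #|T|.+1])
    = #|[set c | block T c <= k]|.
  move=> kT; rewrite -map_take sum_blocks ?take_uniq ?iota_uniq //.
  apply: eq_card => c; rewrite !inE take_iota mem_iota.
  by have : 0 < block T c by []; lia.
apply/mapP/idP => [[k]|/block_card [k kT ek]].
  by rewrite mem_iota add1n ltnS => /andP [k0 kT]; rewrite sumE // => ek; apply/block_card; exists k; rewrite ?k0.
exists k; first by rewrite mem_iota add1n ltnS.
by rewrite sumE //; case/andP: kT.
Qed.

(** Partial sums taken from the largest coordinate down count the complements of unions of first
    blocks; they are $n$ minus the cut points, whence the reversal. *)
Lemma set_of_comp_down :
  set_of_comp n [seq count (fun b => g b == x) D | x <- rev (iota 1 (\max_(b <- D) g b))]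
  = revset T.
Proof.
apply/setP => i; rewrite !inE max_block size_map size_rev size_iota -[_.+1.-1]/(#|T|).
have sumE k : k <= #|T| ->
    sumn (take k [seq count (fun b => g b == x) D | x <- rev (iota 1 #|T|.+1)])
    = n - #|[set c | block T c <= #|T|.+1 - k]|.
  move=> kT; rewrite -map_take sum_blocks ?take_uniq ?rev_uniq ?iota_uniq //.
  have := cardsC [set c | block T c <= #|T|.+1 - k]; rewrite card_ord => e.
  rewrite -[X in X - _]e addKn.
  apply: eq_card => c; rewrite !inE take_rev size_iota drop_iota mem_rev mem_iota.
  by have := block_bound T c; have : 0 < block T c by []; lia.
have cardn k : #|[set c | block T c <= k]| <= n.
  by apply: leq_trans (max_card _) _; rewrite card_ord.
have iE : (rev_ord i).+1 = n - i.+1 by rewrite /=; have := ltn_ord i; lia.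
apply/mapP/idP => [[k]|/block_card [k /andP [k0 kT] ek]].
  rewrite mem_iota add1n ltnS => /andP [k0 kT]; rewrite sumE // => ek.
  apply/block_card; exists (#|T|.+1 - k); first by lia.
  by rewrite iE ek subKn.
exists (#|T|.+1 - k); first by rewrite mem_iota; lia.
rewrite sumE; last by lia.
by rewrite subKn 1?leqW // -ek iE subKn //; have := ltn_ord i; lia.
Qed.

End CutComposition.

(** * The diagram of $\sigma$ and $S$ *)

Section RightDiagram.

Variables (n : nat) (S : {set 'I_n.-1}) (sigma : 'S_n).
Hypothesis sigma_S : leL sigma (w1 S).
Implicit Types (p q : 'I_n).
Local Notation D := (diagram_right sigma S).
Local Notation col p := (block (~: DesL sigma) (sigma p)).
Local Notation pos := (block S).

(** The blocks of positions are numbered from 1 to [#|S| + 1], and the first one is the top row. *)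
Definition right_box p : nat * nat := (col p, #|S| + 2 - pos p).

Lemma right_mem (b : nat * nat) : (b \in D) = [exists p, b == right_box p].
Proof.
apply/imfsetP/existsP => [[_ /andP [/allpairsP [[i j] [iI jI ->]]] /existsP [r /andP []] + + ->]|[p /eqP ->]].
  rewrite !mem_iota !add1n !ltnS in iI jI; rewrite (in_blockE _ iI) (in_blockE _ jI) /=.
  by move=> /eqP <- /eqP <-; exists r.
exists (pos p, col p) => //; apply/andP; split.
  by apply: allpairs_f; rewrite mem_iota add1n ltnS block_bound.
by apply/existsP; exists p; rewrite !in_blockE ?block_bound ?eqxx.
Qed.

Lemma right_row_le p q : ((right_box p).2 <= (right_box q).2) = (pos q <= pos p).
Proof.
rewrite -[(right_box p).2]/(#|S| + 2 - pos p) -[(right_box q).2]/(#|S| + 2 - pos q).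
by have := block_bound S p; have := block_bound S q; lia.
Qed.

Lemma right_row_lt p q : ((right_box p).2 < (right_box q).2) = (pos q < pos p).
Proof. by rewrite ltnNge right_row_le -ltnNge. Qed.

Lemma right_row_eq p q : ((right_box p).2 == (right_box q).2) = (pos p == pos q).
Proof. by rewrite !eqn_leq !right_row_le andbC. Qed.

Lemma right_pos p q : p < q -> pos p = pos q -> sigma p < sigma q.
Proof.
move=> pq e; rewrite perm_ltNge ?ltn_eqF //; apply/negP => /(leLP _ _ sigma_S _ _ pq).
by apply/negP; rewrite -perm_ltNge ?ltn_eqF // w1_block // e.
Qed.

Lemma right_col p q : col p = col q -> sigma p < sigma q -> q < p.
Proof.
move=> e lt; have := block_joined (~: DesL sigma) lt; rewrite e eqxx => /joinedP j.
rewrite -(permK sigma p) -(permK sigma q).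
apply: (@step_gt _ (fun x => (sigma^-1)%g x)) => // k /j.
by rewrite setCK DesLE.
Qed.

Lemma right_box_inj : injective right_box.
Proof.
move=> p q e; have [//|ne] := eqVneq p q; exfalso.
have ec : col p = col q := congr1 fst e.
have er : pos p = pos q by apply/eqP; rewrite -right_row_eq e.
clear e; wlog lt : p q ec er ne / p < q => [hw|].
  case: (ltngtP p q) => [|lt|/val_inj e]; [exact: hw| |by rewrite e eqxx in ne].
  by apply: (hw q p) => //; rewrite eq_sym.
by have := right_col ec (right_pos lt er); lia.
Qed.

Lemma right_box_neq p q : p != q -> col p = col q -> pos p = pos q -> False.
Proof. by move=> ne ec er; case/eqP: ne; apply: right_box_inj; rewrite /right_box ec er. Qed.

Lemma right_box_lt p q : p != q -> weakly_ur (right_box p) (right_box q) ->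
  sigma p < sigma q /\ w1 S p < w1 S q.
Proof.
move=> ne /andP []; rewrite right_row_le => lec ler; rewrite /= in lec.
have inj := right_box_neq ne; have nev : p != q :> nat by rewrite val_eqE.
split.
  rewrite ltnNge; apply/negP => le.
  have lt : sigma q < sigma p by rewrite ltn_neqAle le andbT perm_val_eq eq_sym.
  have ec : col p = col q by apply/eqP; rewrite eqn_leq lec block_le.
  have pq := right_col (esym ec) lt.
  by apply: inj => //; apply/eqP; rewrite eqn_leq ler block_le // ltnW.
case: (ltngtP p q) nev => // lt _.
  by rewrite w1_block // eqn_leq ler block_le // ltnW.
rewrite perm_ltNge ?gtn_eqF // w1_block //; apply/negP => /eqP er.
apply: inj => //; apply/eqP; rewrite eqn_leq lec block_le // ltnW //.
exact: right_pos.
Qed.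

(** [w0 (DesL sigma)] reverses the values inside each column, so the inverse of [right_u] ranks
    positions as in [order_down]. *)
Definition right_u : 'S_n := ((pcomp (w0 (DesL sigma)) sigma)^-1)%g.

Lemma right_uV p : (right_u^-1)%g p = w0 (DesL sigma) (sigma p).
Proof. by rewrite invgK pcompE. Qed.

Lemma right_u_lt p q : sigma p < sigma q -> ((right_u^-1)%g q < (right_u^-1)%g p) = (col p == col q).
Proof. by move=> lt; rewrite !right_uV -{1 2}(setCK (DesL sigma)) w0_block. Qed.

Lemma right_uV_lt p q : (right_u^-1)%g p < (right_u^-1)%g q ->
  lexr fst snd ltn gtn (right_box p) (right_box q).
Proof.
move=> lt; rewrite /lexr /= -[_ - _ < _]/((right_box q).2 < (right_box p).2) right_row_lt.
case: (ltngtP (sigma p) (sigma q)) => [pq|qp|/val_inj/perm_inj e]; last by rewrite e ltnn in lt.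
  rewrite ltn_neqAle block_le ?andbT; last exact: ltnW.
  rewrite -right_u_lt //; lia.
move: lt; rewrite right_u_lt // => /eqP ec; rewrite ec ltnn eqxx /=.
have pq := right_col ec qp; rewrite ltn_neqAle block_le ?andbT; last exact: ltnW.
apply/negP => /eqP er; apply: (@right_box_neq p q) => //.
by apply/negP => /eqP e; rewrite e ltnn in pq.
Qed.

Lemma right_box_u p q : p < q -> (right_u^-1)%g q < (right_u^-1)%g p ->
  strictly_ur (right_box p) (right_box q) || strictly_ur (right_box q) (right_box p).
Proof.
move=> pq /right_uV_lt; rewrite /strictly_ur !right_row_lt /lexr.
have le := block_le S (ltnW pq).
case/orP => [lt|/andP [_ lt]]; last first.
  have : pos q < pos p by rewrite -right_row_lt; exact: lt.
  by lia.
rewrite [X in _ || X]andbC; apply/orP; right; apply/andP; split; last exact: lt.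
rewrite ltn_neqAle le andbT; apply/negP => /eqP er.
by have := right_pos pq er; have := block_lt lt; lia.
Qed.

Lemma right_w1_lt p q : (((w1 S)^-1)^-1)%g p < (((w1 S)^-1)^-1)%g q ->
  lexr snd fst ltn ltn (right_box p) (right_box q).
Proof.
rewrite invgK => lt.
have ne : q != p by apply/negP => /eqP e; rewrite e ltnn in lt.
have h := right_box_lt ne.
suff : (pos q < pos p) || (pos p == pos q) && ((right_box p).1 < (right_box q).1).
  by rewrite -right_row_lt -right_row_eq.
case: (ltngtP (pos p) (pos q)) => //= [qp|er].
  have lpq := block_lt qp; have := w1_block S lpq.
  by rewrite lt => /esym; lia.
rewrite ltnNge; apply/negP => le; have [|_] := h; last by lia.
by rewrite /weakly_ur right_row_le er leqnn andbT.
Qed.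

Lemma right_reading :
  perm_of_word n (w_LB D (F_down D)) = pcomp (right_u^-1)%g (w1 S)^-1%g.
Proof.
have box_pos p : (0 < (right_box p).1) && (0 < (right_box p).2).
  rewrite -[(right_box p).2]/(#|S| + 2 - pos p) [X in X && _]isT.
  by have := block_bound S p; lia.
apply: (perm_of_readings right_box_inj).
  exact: (order_LBE right_mem box_pos right_w1_lt).
exact: (order_downE right_mem box_pos right_uV_lt).
Qed.

Lemma right_bottom : pcomp sigma right_u = w0 (DesL sigma).
Proof.
rewrite /right_u pcompV w0V pcompA -[RHS](mulg1 _); congr (_ * _)%g.
exact: mulVg.
Qed.

End RightDiagram.

Theorem corollary4p19 (R : realType) (n : nat) (hn : (0 < n)%N)
    (S : {set 'I_n.-1}) (rho sigma : 'S_n)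
    (hrho : leL (w0 S) rho) (hsigma : leL sigma (w1 S)) :
  (no_upper_right (diagram_left S rho) ->
   is_injective_hull
     (Bmod R[i] (w0 S) rho)
     (Bmod R[i]
        (w0 (DesL (perm_of_word n
               (w_BL (diagram_left S rho) (F_right (diagram_left S rho))))))
        (w1 (set_of_comp n (row_comp (diagram_left S rho)))))) /\
  (no_upper_right (diagram_right sigma S) ->
   is_projective_cover
     (Bmod R[i] sigma (w1 S))
     (Bmod R[i]
        (w0 (~: set_of_comp n (col_comp (diagram_right sigma S))))
        (w1 (DesL (perm_of_word n
               (w_LB (diagram_right sigma S)
                     (F_down (diagram_right sigma S)))))))).
Proof.
split=> no_ur.
  have DE := left_mem S rho.
  have Desu := DesL_translate DE no_ur (left_box_lt hrho) (left_box_u hrho).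
  have -> : set_of_comp n (row_comp (diagram_left S rho)) = revset (DesL rho).
    exact: (set_of_comp_down hn (left_box_inj hrho) DE (z := rho) (g := snd)).
  (* The word is the inverse of the translated bottom [pcomp (w0 S) (left_u rho)], so its left
     descents are the right descents required by [interval_hull]. *)
  rewrite left_reading // -pcompV DesLV.
  by apply: interval_hull => //; exact: left_top.
have DE := right_mem S sigma.
have Desu := DesL_translate DE no_ur (right_box_lt hsigma) (right_box_u hsigma).
have -> : set_of_comp n (col_comp (diagram_right sigma S)) = ~: DesL sigma.
  exact: (set_of_comp_up hn (right_box_inj hsigma) DE (z := sigma) (g := fst)).
(* Likewise the word is the inverse of the translated top, whose right descent set is the [T] of
   [interval_cover]. *)
rewrite setCK right_reading // -pcompV DesLV.
have [fgP proj [f fsurj fess]] : strong_cover (Bmod R[i] sigma (w1 S)) _ :=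
  interval_cover _ hsigma Desu (right_bottom sigma).
split=> //; first by move=> X Y g h _ _; apply: proj.
by exists f; split=> // X g _; apply: fess.
Qed.
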